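(* Let $F$ be a real closed field, let $n \in \mathbb{N}$, and let $(D,\vartheta) \in \{(F,\mathrm{id}), (F(\sqrt{-1}),-), ((-1,-1)_F,-)\}$. Let $T$ be the theory (without parameters) of $(M_n(D),\vartheta^t)$ in the language $L := L_{\text{CSA-I}} \cup \{\underline{P}, \underline{\mathrm{Trd}}\}$, where $\underline{P}$ is interpreted as the order on $F$, and $\underline{\mathrm{Trd}}$ as the reduced trace map. Then $T$ has quantifier elimination in $L$.
   Context: $(-1,-1)_F$ is the quaternion algebra over $F$ with basis $\{1,i,j,k\}$, $i^2=j^2=-1$, $ij=-ji=k$; the symbol $-$ denotes the canonical $F$-linear involution (conjugation) on $F(\sqrt{-1})$ and on $(-1,-1)_F$. $\vartheta^t$ is the involution on $M_n(D)$ given by $(a_{rs}) \mapsto (\vartheta(a_{sr}))$. $L_{\text{CSA-I}} := L_R \cup \{\underline{F}, \underline{\sigma}\}$, where $L_R$ is the language of (unital) rings, $\underline{F}$ is a unary relation symbol and $\underline{\sigma}$ a unary function symbol. In $(M_n(D),\vartheta^t)$, $\underline{\sigma}$ is interpreted by $\vartheta^t$ and $\underline{F}$ by the set of elements of the centre that are fixed by $\vartheta^t$ (i.e. $F$, identified with scalar matrices). $\underline{P}$ is a unary relation symbol, interpreted by the set of elements of $F$ that are $\ge 0$. $\underline{\mathrm{Trd}}$ is a unary function symbol. For a central simple algebra $A$ over $K = Z(A)$, the reduced trace $\mathrm{Trd}_A : A \to K$ is $\mathrm{Trd}_A(a) = \mathrm{tr}(f(a \otimes 1))$, where $E \supseteq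 K$ is a splitting field and $f : A \otimes_K E \to M_r(E)$ is an $E$-algebra isomorphism (the result is independent of the choices and lies in $K$). *)

(* Defs.v *)
From HB Require Import structures.
From mathcomp Require Import all_boot all_order all_algebra.
From mathcomp Require Import complex.
From mathcomp Require Import ring.
Set Implicit Arguments.
Unset Strict Implicit.
Unset Printing Implicit Defensive.
Import Order.TTheory GRing.Theory Num.Theory.
Local Open Scope ring_scope.

(** * First-order logic over L = L_R + {F, sigma, P, Trd} *)

Inductive term : Type :=
| Var (i : nat)
| Zero
| One
| Add (t u : term)
| Opp (t : term)
| Mul (t u : term)
| Sigma (t : term)
| Trd (t : term).

Inductive formula : Type :=
| Equal (t u : term)
| InF (t : term)
| InP (t : term)
| Bot
| Not (f : formula)
| And (f g : formula)
| Or (f g : formula)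
| Implies (f g : formula)
| Exists (i : nat) (f : formula)
| Forall (i : nat) (f : formula).

Fixpoint term_vars (t : term) : seq nat :=
  match t with
  | Var i => [:: i]
  | Zero | One => [::]
  | Add t u | Mul t u => term_vars t ++ term_vars u
  | Opp t | Sigma t | Trd t => term_vars t
  end.

Fixpoint free_vars (f : formula) : seq nat :=
  match f with
  | Equal t u => term_vars t ++ term_vars u
  | InF t | InP t => term_vars t
  | Bot => [::]
  | Not f => free_vars f
  | And f g | Or f g | Implies f g => free_vars f ++ free_vars g
  | Exists i f | Forall i f => [seq j <- free_vars f | j != i]
  end.

Definition sentence (f : formula) : Prop := free_vars f = [::].

Fixpoint quantifier_free (f : formula) : bool :=
  match f with
  | Equal _ _ | InF _ | InP _ | Bot => true
  | Not f => quantifier_free f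
  | And f g | Or f g | Implies f g => quantifier_free f && quantifier_free g
  | Exists _ _ | Forall _ _ => false
  end.

Record Lstructure := {
  dom :> Type;
  s_zero : dom;
  s_one : dom;
  s_add : dom -> dom -> dom;
  s_opp : dom -> dom;
  s_mul : dom -> dom -> dom;
  s_sigma : dom -> dom;
  s_trd : dom -> dom;
  s_F : dom -> Prop;
  s_P : dom -> Prop
}.

Fixpoint eval (M : Lstructure) (e : nat -> M) (t : term) : M :=
  match t with
  | Var i => e i
  | Zero => s_zero M
  | One => s_one M
  | Add t u => s_add (eval e t) (eval e u)
  | Opp t => s_opp (eval e t)
  | Mul t u => s_mul (eval e t) (eval e u)
  | Sigma t => s_sigma (eval e t)
  | Trd t => s_trd (eval e t)
  end.

Definition update (T : Type) (e : nat -> T) (i : nat) (x : T) : nat -> T :=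
  fun j => if j == i then x else e j.

Fixpoint holds (M : Lstructure) (e : nat -> M) (f : formula) : Prop :=
  match f with
  | Equal t u => eval e t = eval e u
  | InF t => s_F (eval e t)
  | InP t => s_P (eval e t)
  | Bot => False
  | Not f => ~ holds e f
  | And f g => holds e f /\ holds e g
  | Or f g => holds e f \/ holds e g
  | Implies f g => holds e f -> holds e g
  | Exists i f => exists x : M, holds (update e i x) f
  | Forall i f => forall x : M, holds (update e i x) f
  end.

Definition theory := formula -> Prop.

Definition theory_of (M : Lstructure) : theory :=
  fun f => sentence f /\ forall e : nat -> M, holds e f.

Definition models (N : Lstructure) (T : theory) : Prop :=
  forall f, T f -> forall e : nat -> N, holds e f.

Definition equivalent_modulo (T : theory) (f g : formula) : Prop :=
  forall N : Lstructure, models N T ->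
  forall e : nat -> N, holds e f <-> holds e g.

Definition quantifier_elimination (T : theory) : Prop :=
  forall f : formula, exists g : formula,
    [/\ quantifier_free g,
        {subset free_vars g <= free_vars f}
      & equivalent_modulo T f g].

(** * The quaternion algebra (-1,-1)_F *)

(* Quat a b c d stands for a + b i + c j + d k. *)
Record quaternion (F : Type) := Quat { q1 : F; qi : F; qj : F; qk : F }.

Section QuaternionChoice.
Variable F : Type.
Definition quat_to (x : quaternion F) := (q1 x, qi x, qj x, qk x).
Definition quat_of (x : F * F * F * F) : quaternion F :=
  let: (a, b, c, d) := x in Quat a b c d.
Lemma quat_toK : cancel quat_to quat_of. Proof. by case. Qed.
End QuaternionChoice.

HB.instance Definition _ (F : eqType) :=
  Equality.copy (quaternion F) (can_type (@quat_toK F)).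
HB.instance Definition _ (F : choiceType) :=
  Choice.copy (quaternion F) (can_type (@quat_toK F)).

Section QuaternionRing.
Variable F : comNzRingType.
Implicit Types x y z : quaternion F.

Definition quat_zero : quaternion F := Quat 0 0 0 0.
Definition quat_add x y : quaternion F :=
  Quat (q1 x + q1 y) (qi x + qi y) (qj x + qj y) (qk x + qk y).
Definition quat_opp x : quaternion F :=
  Quat (- q1 x) (- qi x) (- qj x) (- qk x).
Definition quat_one : quaternion F := Quat 1 0 0 0.
(* The bilinear product determined by i^2 = j^2 = -1 and ij = -ji = k,
   see quat_ii, quat_jj, quat_ij and quat_ji. *)
Definition quat_mul x y : quaternion F :=
  Quat (q1 x * q1 y - qi x * qi y - qj x * qj y - qk x * qk y)
       (q1 x * qi y + qi x * q1 y + qj x * qk y - qk x * qj y)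
       (q1 x * qj y - qi x * qk y + qj x * q1 y + qk x * qi y)
       (q1 x * qk y + qi x * qj y - qj x * qi y + qk x * q1 y).

Let quat_addA : associative quat_add.
Proof. by move=> x y z; rewrite /quat_add /= !addrA. Qed.
Let quat_addC : commutative quat_add.
Proof. by move=> x y; congr Quat; rewrite addrC. Qed.
Let quat_add0 : left_id quat_zero quat_add.
Proof. by case=> a b c d; rewrite /quat_add /= !add0r. Qed.
Let quat_addN : left_inverse quat_zero quat_opp quat_add.
Proof. by move=> x; rewrite /quat_add /= !addNr. Qed.

HB.instance Definition _ := GRing.isZmodule.Build (quaternion F)
  quat_addA quat_addC quat_add0 quat_addN.

Let quat_mulA : associative quat_mul.
Proof. by move=> x y z; congr Quat => /=; ring. Qed.
Let quat_mul1l : left_id quat_one quat_mul.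
Proof. by case=> a b c d; congr Quat => /=; ring. Qed.
Let quat_mul1r : right_id quat_one quat_mul.
Proof. by case=> a b c d; congr Quat => /=; ring. Qed.
Let quat_mulDl : left_distributive quat_mul +%R.
Proof. by move=> x y z; congr Quat => /=; ring. Qed.
Let quat_mulDr : right_distributive quat_mul +%R.
Proof. by move=> x y z; congr Quat => /=; ring. Qed.
Let quat_one_neq0 : quat_one != 0.
Proof. by apply/eqP => -[] /eqP; rewrite oner_eq0. Qed.

HB.instance Definition _ := GRing.Zmodule_isNzRing.Build (quaternion F)
  quat_mulA quat_mul1l quat_mul1r quat_mulDl quat_mulDr quat_one_neq0.

Definition quat_scalar (a : F) : quaternion F := Quat a 0 0 0.
Definition quat_conj x : quaternion F :=
  Quat (q1 x) (- qi x) (- qj x) (- qk x).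

Definition quat_i : quaternion F := Quat 0 1 0 0.
Definition quat_j : quaternion F := Quat 0 0 1 0.
Definition quat_k : quaternion F := Quat 0 0 0 1.

Lemma quat_decomp (a b c d : F) :
  Quat a b c d = quat_scalar a + quat_scalar b * quat_i
               + quat_scalar c * quat_j + quat_scalar d * quat_k.
Proof. by congr Quat => /=; ring. Qed.
Lemma quat_ii : quat_i * quat_i = -1.
Proof. by congr Quat => /=; ring. Qed.
Lemma quat_jj : quat_j * quat_j = -1.
Proof. by congr Quat => /=; ring. Qed.
Lemma quat_ij : quat_i * quat_j = quat_k.
Proof. by congr Quat => /=; ring. Qed.
Lemma quat_ji : quat_j * quat_i = - quat_k.
Proof. by congr Quat => /=; ring. Qed.
End QuaternionRing.

(** * The pairs (D, vartheta) *)

Record inv_alg (F : rcfType) := InvAlg {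
  inv_ring :> nzRingType;
  inv_scalar : F -> inv_ring; (* the structure map of the F-algebra *)
  inv_map : inv_ring -> inv_ring
}.

Definition real_alg (F : rcfType) : inv_alg F :=
  @InvAlg F F id id.
Definition complex_alg (F : rcfType) : inv_alg F :=
  @InvAlg F F[i] (real_complex F) (@conjc F).
Definition quaternion_alg (F : rcfType) : inv_alg F :=
  @InvAlg F (quaternion F) (@quat_scalar F) (@quat_conj F).

Definition inv_trmx (F : rcfType) (D : inv_alg F) (n : nat) (a : 'M[D]_n) :
  'M[D]_n := map_mx (@inv_map F D) a^T.

(** * The reduced trace *)

Definition central (A : pzRingType) (x : A) : Prop :=
  forall y : A, GRing.comm x y.

(* [g] is a |-> f (a (x) 1) for an algebra isomorphism
   f : A (x)_K E -> M_r(E), where K = Z(A).  A ring morphism g that maps K to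
   scalar matrices makes E an extension of K and induces
   f (a (x) e) = e *: g a; since (b_i (x) 1)_i is an E-basis of A (x)_K E
   whenever (b_i)_i is a K-basis of A, f is bijective iff the last clause
   holds. *)
Definition splitting (A : pzRingType) (E : fieldType) (r : nat)
    (g : {rmorphism A -> 'M[E]_r}) : Prop :=
  (forall c : A, central c -> is_scalar_mx (g c)) /\
  exists (I : finType) (b : I -> A),
    (forall a : A, exists! c : {ffun I -> A},
       (forall i, central (c i)) /\ a = \sum_i c i * b i) /\
    bijective (fun c : {ffun I -> E} => \sum_i c i *: g (b i)).

(* The reduced trace is a map A -> Z(A); an element c of Z(A) is identified
   with the element of E whose scalar matrix is g c. *)
Definition is_reduced_trace (A : pzRingType) (trd : A -> A) : Prop :=
  exists (E : fieldType) (r : nat) (g : {rmorphism A -> 'M[E]_r}),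
    splitting g /\
    forall a : A, central (trd a) /\ g (trd a) = (\tr (g a))%:M.

(** * The L-structure on M_n(D) *)

Definition matrix_structure (F : rcfType) (D : inv_alg F) (n : nat)
    (trd : 'M[D]_n -> 'M[D]_n) : Lstructure := {|
  dom := 'M[D]_n;
  s_zero := 0;
  s_one := 1%:M;
  s_add := fun a b => a + b;
  s_opp := fun a => - a;
  s_mul := fun a b => a *m b;
  s_sigma := @inv_trmx F D n;
  s_trd := trd;
  s_F := fun a => central a /\ inv_trmx a = a;
  s_P := fun a => exists2 c : F, 0 <= c & a = (inv_scalar D c)%:M
|}.

(* Main.v *)
From HB Require Import structures.
Require Import Defs.
From mathcomp Require Import all_boot all_order all_algebra.
From mathcomp Require Import complex mxtens spectral ring lra zify.
From mathcomp Require qe_rcf_th qe_rcf.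
From Stdlib Require Import Classical.
Set Implicit Arguments.
Unset Strict Implicit.
Unset Printing Implicit Defensive.
Import Order.TTheory GRing.Theory Num.Theory.
Local Open Scope ring_scope.

(** Over the real closed field [F] the structure [M = M_n(D)] is interpreted in
[F] by coordinates, so a formula of [L] in [k] variables defines a semialgebraic
subset of [M^k].  Such a set is invariant under the automorphisms of [M], among
which are the conjugations by unitary matrices and, when [D] is the field
[F(sqrt -1)], the entrywise conjugation.  The orbits are separated by finitely
many traces: if the reduced traces of all words of bounded length in the
matrices and their adjoints agree on two tuples, then the tuples are unitarily
equivalent.  In the complex case the language sees a trace only up to complex
conjugation, through its real part and the products of two imaginary parts; this
is just the ambiguity left by entrywise conjugation.  So a formula [f] holds at a
tuple exactly when the vector of its invariants lies in the projection, along the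
tuple, of the graph of the invariants restricted to [f].  By the elimination of
quantifiers for real closed fields this projection has a quantifier-free
definition.  The invariants are values of terms of [L] lying in [F], so this
definition can be read back in [M], with [P] playing the part of the order.

Two points need care.  First, [L] has no names for the elements of [F], so the
elimination over [F] has to keep the constants rational: this is checked along
the Sturm-sequence procedure ([rat_CcountGt0], [rational_set_exists]), and
denominators are cleared in [realize_term].  Secondly, the unitary equivalence is
needed over an arbitrary real closed field, where no compactness is available.
Theorem [specht] proves it for real matrices.  Given families [A] and [B] with
the same traces, the double commutant theorem [bicommutant] yields a nonzero
matrix [T] intertwining them ([nonzero_intertwiner]): otherwise the projection
onto one summand would lie in the algebra generated by the block sums
[A_i + B_i], on which both blocks have the same trace.  On an eigenspace of
[T^T *m T], [T] is a multiple of an isometry; splitting it off on both sides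
preserves the traces, and one concludes by induction on the rank
([partial_isometry]).  The general case reduces to this one by letting [M_n(D)]
act on the left of [D^n]: the real matrices so obtained are those commuting with
the right multiplications, and the latter are simply added to the families
([unitary_equivalence]).

Everything about the reduced trace comes from one remark: modulo commutators a
matrix is a central scalar ([tracial_ctr_mx]).  Hence an additive functional
vanishing on commutators factors through the reduced trace, which determines the
reduced trace itself up to its value at [1] ([reduced_traceE]). *)

(** * First-order logic *)

Section Semantics.
Variable M : Lstructure.
Implicit Types (e : nat -> M) (t : term) (f : formula).

Lemma eval_ext t e e' : {in term_vars t, e =1 e'} -> eval e t = eval e' t.
Proof.
have sub (s1 s2 : seq nat) : {in s1 ++ s2, e =1 e'} -> {in s1, e =1 e'} /\ {in s2, e =1 e'}.
  by move=> h; split=> j js; apply: h; rewrite mem_cat js ?orbT.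
elim: t => //= [i|t IHt u IHu|t IH|t IHt u IHu|t IH|t IH].
- by apply; rewrite mem_seq1.
- by move=> /sub[/IHt-> /IHu->].
- by move=> /IH->.
- by move=> /sub[/IHt-> /IHu->].
- by move=> /IH->.
- by move=> /IH->.
Qed.

Lemma holds_ext f e e' : {in free_vars f, e =1 e'} -> holds e f <-> holds e' f.
Proof.
have sub (s t : seq nat) e1 e2 : {in s ++ t, e1 =1 e2 :> (nat -> M)} ->
    {in s, e1 =1 e2} /\ {in t, e1 =1 e2}.
  by move=> h; split=> j js; apply: h; rewrite mem_cat js ?orbT.
have upd (s : seq nat) i x e1 e2 : {in [seq j <- s | j != i], e1 =1 e2 :> (nat -> M)} ->
    {in s, update e1 i x =1 update e2 i x}.
  move=> h j js; rewrite /update; case: (eqVneq j i) => // ji.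
  by apply: h; rewrite mem_filter ji.
elim: f e e' => //= [t u|t|t|f IH|f IHf g IHg|f IHf g IHg|f IHf g IHg|i f IH|i f IH] e e'.
- by move=> /sub[/eval_ext-> /eval_ext->].
- by move=> /eval_ext->.
- by move=> /eval_ext->.
- by move=> /IH; tauto.
- by move=> /sub[/IHf + /IHg]; tauto.
- by move=> /sub[/IHf + /IHg]; tauto.
- by move=> /sub[/IHf + /IHg]; tauto.
- by move=> h; split=> -[x] hx; exists x; move: hx; apply IH; apply: upd => // j /h.
- by move=> h; split=> hx x; move: (hx x); apply IH; apply: upd => // j /h.
Qed.

Definition automorphism (phi psi : M -> M) : Prop :=
  (cancel phi psi /\ cancel psi phi) /\
  (phi (s_zero M) = s_zero M /\ phi (s_one M) = s_one M) /\
  [/\ forall x y, phi (s_add x y) = s_add (phi x) (phi y),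
      forall x y, phi (s_mul x y) = s_mul (phi x) (phi y),
      forall x, phi (s_opp x) = s_opp (phi x),
      forall x, phi (s_sigma x) = s_sigma (phi x) &
      forall x, phi (s_trd x) = s_trd (phi x)] /\
  (forall x, s_F (phi x) <-> s_F x) /\ (forall x, s_P (phi x) <-> s_P x).

(** This is why a parameter-free definable set is a union of orbits of the
automorphism group; the inverse [psi] carries witnesses back through the
quantifiers. *)
Lemma holds_automorphism phi psi f e :
  automorphism phi psi -> holds (fun i => phi (e i)) f <-> holds e f.
Proof.
move=> [[phiK psiK] [[phi0 phi1] [[phiD phiM phiN phiS phiT] [phiF phiP]]]].
have ev t e1 : eval (fun i => phi (e1 i)) t = phi (eval e1 t).
  by elim: t => //= [t -> u ->|t ->|t -> u ->|t ->|t ->].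
have upd e1 i x g : holds (update (fun i => phi (e1 i)) i (phi x)) g <->
                    holds (fun j => phi (update e1 i x j)) g.
  by apply: holds_ext => j _; rewrite /update; case: eqP.
elim: f e => //= [t u|t|t|f IH|f IHf g IHg|f IHf g IHg|f IHf g IHg|i f IH|i f IH] e.
- by rewrite !ev; split=> [/(can_inj phiK)|->].
- by rewrite ev.
- by rewrite ev.
- by rewrite IH.
- by rewrite IHf IHg.
- by rewrite IHf IHg.
- by rewrite IHf IHg.
- split=> -[x]; first by rewrite -(psiK x) upd IH => hx; exists (psi x).
  by rewrite -IH -upd => hx; exists (phi x).
- split=> h x; first by rewrite -IH -upd.
  by rewrite -(psiK x) upd IH.
Qed.

End Semantics.

(** The theory of [M] contains the universal closure of every equivalence that
holds in [M], so that it suffices to eliminate quantifiers in [M] itself. *)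
Lemma quantifier_elimination_theory_of (M : Lstructure) :
    (forall f, exists g, [/\ quantifier_free g, {subset free_vars g <= free_vars f} &
      forall e : nat -> M, holds e f <-> holds e g]) ->
  quantifier_elimination (theory_of M).
Proof.
move=> QE f; have [g [qg gf fg]] := QE f; exists g; split=> // N NT e.
pose h := Defs.And (Defs.Implies f g) (Defs.Implies g f).
pose closure s := foldr Forall h s.
have fv s : free_vars (closure s) = [seq j <- free_vars h | j \notin s].
  elim: s => [|i s IH]; first by rewrite /closure [RHS]filter_predT.
  by rewrite /= IH -filter_predI; apply: eq_filter => j; rewrite /= inE negb_or.
have hM s (e' : nat -> M) : holds e' (closure s).
  elim: s e' => [|i s IH] e'; first by rewrite /= fg.
  by move=> x; exact: IH.
have hN s (e' : nat -> N) : holds e' (closure s) -> holds e' h.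
  (* updating [e'] at [i] with its own value [e' i] changes nothing *)
  elim: s e' => [//|i s IH] e' /= /(_ (e' i)) /IH.
  by apply: (holds_ext _).1 => j _; rewrite /update; case: eqP => [->|].
have /hN[] : holds e (closure (free_vars h)).
  apply: NT; split; last exact: hM.
  by rewrite /sentence fv -(filter_pred0 (free_vars h)); apply: eq_in_filter => j ->.
by split.
Qed.

(** * Quantifier elimination with rational constants *)

Section RationalQE.
Variable F : rcfType.

(** Up to denominators, the constants that formulas of [L] can express. *)
Definition rational (x : F) := exists q : rat, x = ratr q.

Lemma rational0 : rational 0. Proof. by exists 0; rewrite rmorph0. Qed.
Lemma rational1 : rational 1. Proof. by exists 1; rewrite rmorph1. Qed.
Lemma rationalD x y : rational x -> rational y -> rational (x + y).
Proof. by move=> [a ->] [b ->]; exists (a + b); rewrite rmorphD. Qed.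
Lemma rationalN x : rational x -> rational (- x).
Proof. by move=> [a ->]; exists (- a); rewrite rmorphN. Qed.
Lemma rationalM x y : rational x -> rational y -> rational (x * y).
Proof. by move=> [a ->] [b ->]; exists (a * b); rewrite rmorphM. Qed.
Lemma rationalV x : rational x -> rational x^-1.
Proof. by move=> [a ->]; exists a^-1; rewrite fmorphV. Qed.
Lemma rational_nat n : rational n%:R.
Proof. by exists n%:R; rewrite ratr_nat. Qed.
Lemma rational_int n : rational n%:~R.
Proof. by exists n%:~R; rewrite ratr_int. Qed.

Notation tF := (qe_rcf.term F).
Notation fF := (qe_rcf.formula F).

Fixpoint rat_term (t : tF) : Prop :=
  match t with
  | qe_rcf.Var _ | qe_rcf.NatConst _ => True
  | qe_rcf.Const x => rational x
  | qe_rcf.Add u v | qe_rcf.Mul u v => rat_term u /\ rat_term v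
  | qe_rcf.Opp u | qe_rcf.NatMul u _ | qe_rcf.Exp u _ => rat_term u
  end.

Fixpoint rat_form (f : fF) : Prop :=
  match f with
  | qe_rcf.Bool _ => True
  | qe_rcf.Equal u v | qe_rcf.Lt u v | qe_rcf.Le u v => rat_term u /\ rat_term v
  | qe_rcf.And f g | qe_rcf.Or f g | qe_rcf.Implies f g => rat_form f /\ rat_form g
  | qe_rcf.Not f => rat_form f
  end.

Fixpoint each (T : Type) (P : T -> Prop) (s : seq T) : Prop :=
  if s is x :: s' then P x /\ each P s' else True.

Notation rat_poly := (each rat_term).

Lemma each_nth T (P : T -> Prop) x0 s i : P x0 -> each P s -> P (nth x0 s i).
Proof. by move=> P0; elim: s i => [|x s IH] [|i] //= [Px /IH]. Qed.

Lemma each_map T U (P : T -> Prop) (Q : U -> Prop) (f : T -> U) s :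
  (forall x, P x -> Q (f x)) -> each P s -> each Q (map f s).
Proof. by move=> fPQ; elim: s => //= x s IH [/fPQ Qx /IH]. Qed.

Lemma each_cat T (P : T -> Prop) s1 s2 : each P s1 -> each P s2 -> each P (s1 ++ s2).
Proof. by elim: s1 => //= x s IH [Px /IH Ps /Ps]. Qed.

Lemma each_map_in (T : eqType) U (P : U -> Prop) (f : T -> U) s :
  (forall x, x \in s -> P (f x)) -> each P (map f s).
Proof.
elim: s => //= x s IH Ps; split; first by apply: Ps; rewrite mem_head.
by apply: IH => y ys; apply: Ps; rewrite inE ys orbT.
Qed.

Let r0 := rational0.
Let rN1 := rationalN rational1.

(** The elimination procedure is written in continuation-passing style.  For each
of its steps, a lemma [rat_*] below says that it builds a formula with rational
constants, provided that its continuation does so on rational arguments. *)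
Lemma rat_Size p k : rat_poly p -> (forall n, rat_form (k n)) ->
  rat_form (qe_rcf.Size p k).
Proof.
elim: p k => [|c p IH] k //= [rc rp] rk.
by rewrite /qe_rcf.bind_def; apply: IH => // -[|n] //=.
Qed.

Lemma rat_Isnull p k : rat_poly p -> (forall b, rat_form (k b)) ->
  rat_form (qe_rcf.Isnull p k).
Proof. by move=> rp rk; apply: rat_Size => // n; apply: rk. Qed.

Lemma rat_LtSize p q k : rat_poly p -> rat_poly q -> (forall b, rat_form (k b)) ->
  rat_form (qe_rcf.LtSize p q k).
Proof. by move=> rp rq rk; apply: rat_Size => // n; apply: rat_Size => // m; apply: rk. Qed.

Lemma rat_LeadCoef p k : rat_poly p -> (forall t, rat_term t -> rat_form (k t)) ->
  rat_form (qe_rcf.LeadCoef p k).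
Proof.
elim: p k => [|c p IH] k /=; first by move=> _; apply.
by move=> [rc rp] rk; rewrite /qe_rcf.bind_def; apply: IH => // t rt /=; do !split=> //; apply: rk.
Qed.

Lemma rat_AmulXn a n : rat_term a -> rat_poly (qe_rcf.AmulXn a n).
Proof. by move=> ra; elim: n => //= n IH; split. Qed.

Lemma rat_AddPoly p q : rat_poly p -> rat_poly q -> rat_poly (qe_rcf.AddPoly p q).
Proof. by elim: p q => [|a p IH] [|b q] //= [ra rp] [rb rq]; do !split=> //; apply: IH. Qed.

Lemma rat_ScalPoly c p : rat_term c -> rat_poly p -> rat_poly (qe_rcf.ScalPoly c p).
Proof. by move=> rc; apply: each_map. Qed.

Lemma rat_MulPoly p q : rat_poly p -> rat_poly q -> rat_poly (qe_rcf.MulPoly p q).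
Proof.
move=> + rq; elim: p => //= a p IH [ra rp]; apply: rat_AddPoly; first exact: rat_ScalPoly.
by split=> //; apply: IH.
Qed.

Lemma rat_ExpPoly p n : rat_poly p -> rat_poly (qe_rcf.ExpPoly p n).
Proof.
move=> rp; rewrite /qe_rcf.ExpPoly; case: n => // n; rewrite iteropS.
by elim: n => //= n IH; apply: rat_MulPoly.
Qed.

Lemma rat_OppPoly p : rat_poly p -> rat_poly (qe_rcf.OppPoly p).
Proof. by apply: rat_ScalPoly; exact: rN1. Qed.

Lemma rat_Deriv p : rat_poly p -> rat_poly (qe_rcf.Deriv p).
Proof. by elim: p => //= a p IH [ra rp]; apply: rat_AddPoly => //=; split=> //; apply: IH. Qed.

Lemma rat_Rediv_rec_loop q sq cq c qq r n k :
    rat_poly q -> rat_term cq -> rat_poly qq -> rat_poly r ->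
    (forall d, rat_poly d.1.2 -> rat_poly d.2 -> rat_form (k d)) ->
  rat_form (qe_rcf.Rediv_rec_loop q sq cq c qq r n k).
Proof.
move=> rq rcq + + rk; elim: n c qq r => [|n IH] c qq r rqq rr /=;
  rewrite /qe_rcf.bind_def; apply: rat_Size => // m; (case: ifP => _; first exact: rk);
  apply: rat_LeadCoef => // l rl; [apply: rk|apply: IH] => /=;
  do ?[apply: rat_AddPoly|apply: rat_MulPoly|apply: rat_AmulXn|apply: rat_OppPoly] => //=.
Qed.

Lemma rat_Rediv p q k : rat_poly p -> rat_poly q ->
    (forall d, rat_poly d.1.2 -> rat_poly d.2 -> rat_form (k d)) ->
  rat_form (qe_rcf.Rediv p q k).
Proof.
move=> rp rq rk; rewrite /qe_rcf.Rediv /qe_rcf.bind_def; apply: rat_Isnull => // -[].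
  by apply: rk.
apply: rat_Size => // n; apply: rat_Size => // m; apply: rat_LeadCoef => // l rl.
by apply: rat_Rediv_rec_loop.
Qed.

Lemma rat_Rgcd_loop n p q k : rat_poly p -> rat_poly q ->
    (forall r, rat_poly r -> rat_form (k r)) ->
  rat_form (qe_rcf.Rgcd_loop n p q k).
Proof.
move=> + + rk; elim: n p q => [|n IH] p q rp rq /=; rewrite /qe_rcf.bind_def;
  apply: rat_Rediv => // d _ rd; apply: rat_Isnull => // -[]; do ?exact: rk.
by apply: IH.
Qed.

Lemma rat_Rgcd p q k : rat_poly p -> rat_poly q ->
    (forall r, rat_poly r -> rat_form (k r)) ->
  rat_form (qe_rcf.Rgcd p q k).
Proof.
move=> rp rq rk; rewrite /qe_rcf.Rgcd /qe_rcf.bind_def.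
apply: rat_LtSize => // -[]; apply: rat_Isnull => // -[]; do ?exact: rk;
by apply: rat_Size => // n; apply: rat_Rgcd_loop.
Qed.

Lemma rat_BigRgcd ps k : each rat_poly ps ->
  (forall r, rat_poly r -> rat_form (k r)) -> rat_form (qe_rcf.BigRgcd ps k).
Proof.
elim: ps k => [|p ps IH] k /=; first by move=> _; apply.
by move=> [rp rps] rk; apply: IH => // r rr; apply: rat_Rgcd.
Qed.

Lemma rat_Changes s k : rat_poly s -> (forall n, rat_form (k n)) ->
  rat_form (qe_rcf.Changes s k).
Proof.
elim: s k => [|a s IH] k //= [ra rs] rk; apply: IH => // n /=; do !split=> //;
by case: s rs => //= b s [].
Qed.

Lemma rat_SeqPInfty ps k : each rat_poly ps -> (forall s, rat_poly s -> rat_form (k s)) ->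
  rat_form (qe_rcf.SeqPInfty ps k).
Proof.
elim: ps k => [|p ps IH] k /=; first by move=> _; apply.
by move=> [rp rps] rk; apply: rat_LeadCoef => // l rl; apply: IH => // s rs; apply: rk.
Qed.

Lemma rat_SeqMInfty ps k : each rat_poly ps -> (forall s, rat_poly s -> rat_form (k s)) ->
  rat_form (qe_rcf.SeqMInfty ps k).
Proof.
elim: ps k => [|p ps IH] k /=; first by move=> _; apply.
move=> [rp rps] rk; apply: rat_LeadCoef => // l rl; apply: rat_Size => // n.
by apply: IH => // s rs; apply: rk; do !split.
Qed.

Lemma rat_ChangesPoly ps k : each rat_poly ps -> (forall n, rat_form (k n)) ->
  rat_form (qe_rcf.ChangesPoly ps k).
Proof.
move=> rps rk; apply: rat_SeqMInfty => // s rs; apply: rat_SeqPInfty => // s' rs'.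
by apply: rat_Changes => // n; apply: rat_Changes.
Qed.

Lemma rat_NextMod p q k : rat_poly p -> rat_poly q ->
  (forall r, rat_poly r -> rat_form (k r)) -> rat_form (qe_rcf.NextMod p q k).
Proof.
move=> rp rq rk; apply: rat_LeadCoef => // l rl; apply: rat_Rediv => // d _ _.
by apply: rat_Rediv => // d' _ rd'; apply: rk; apply: rat_ScalPoly.
Qed.

Lemma rat_ModsAux p q n k : rat_poly p -> rat_poly q ->
  (forall ps, each rat_poly ps -> rat_form (k ps)) -> rat_form (qe_rcf.ModsAux p q n k).
Proof.
elim: n p q k => [|n IH] p q k rp rq rk /=; first exact: rk.
apply: rat_Isnull => // -[]; first exact: rk.
by apply: rat_NextMod => // r rr; apply: IH => // ps rps; apply: rk.
Qed.

Lemma rat_TaqR p q k : rat_poly p -> rat_poly q -> (forall n, rat_form (k n)) ->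
  rat_form (qe_rcf.TaqR p q k).
Proof.
move=> rp rq rk; rewrite /qe_rcf.TaqR /qe_rcf.bind_def /qe_rcf.Mods.
have rdq : rat_poly (qe_rcf.MulPoly (qe_rcf.Deriv p) q).
  by apply: rat_MulPoly => //; apply: rat_Deriv.
apply: rat_Size => // n; apply: rat_Size => // m; apply: rat_ModsAux => // ps rps.
by apply: rat_ChangesPoly.
Qed.

Lemma rat_PolyComb sq sc : each rat_poly sq -> rat_poly (qe_rcf.PolyComb sq sc).
Proof.
move=> rsq; rewrite /qe_rcf.PolyComb; elim: (iota _ _) => //= i s IH.
by apply: rat_MulPoly => //; apply: rat_ExpPoly; apply: each_nth.
Qed.

Lemma rat_TaqsR p sq i k : rat_poly p -> each rat_poly sq ->
  (forall t, rat_term t -> rat_form (k t)) -> rat_form (qe_rcf.TaqsR p sq i k).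
Proof.
move=> rp rsq rk; apply: rat_TaqR => //; last by move=> n; apply: rk; apply: rational_int.
rewrite /qe_rcf.Pcq; apply: each_nth => //.
by elim: (qe_rcf_th.sg_tab _) => //= sc s IH; split=> //; apply: rat_PolyComb.
Qed.

(** These coefficients are entries of the inverse of an integer matrix, which may
as well be computed over the rational numbers. *)
Lemma rational_coefs n i : rational (qe_rcf_th.coefs F n i).
Proof.
rewrite /qe_rcf_th.coefs; set f := fun _ => _.
have rf j : rational (f j).
  rewrite /f castmxE.
  have -> : map_mx intr (qe_rcf_th.ctmat n) =
      map_mx (ratr : rat -> F) (map_mx intr (qe_rcf_th.ctmat n)).
    by rewrite -map_mx_comp; apply: eq_map_mx => z /=; rewrite ratr_int.
  by rewrite -map_invmx mxE; eexists.
elim: (enum _) i => [|j s IH] [|i] //=; exact: rational0.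
Qed.

Lemma rat_Coefs n i : rat_term (qe_rcf.Coefs F n i).
Proof.
case: n => [|[|n]] /=; [exact: rational_nat| |exact: rational_coefs].
by move: i => [|[|[|i]]] //=; rewrite ?nth_nil; do ?exact: rational0; apply/rationalV/rational_nat.
Qed.

Lemma rat_CcountWeak p sq k : rat_poly p -> each rat_poly sq ->
  (forall t, rat_term t -> rat_form (k t)) -> rat_form (qe_rcf.CcountWeak p sq k).
Proof.
move=> rp rsq rk; rewrite /qe_rcf.CcountWeak.
have : rat_term (qe_rcf.NatConst F 0) by [].
move: (qe_rcf.NatConst F 0) => t; elim: (3 ^ _)%N t => [|n IH] t rt; first exact: rk.
apply: rat_TaqsR => // u ru; apply: IH => /=; do !split=> //; exact: rat_Coefs.
Qed.

Lemma rat_CcountGt0 sp sq : each rat_poly sp -> each rat_poly sq ->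
  rat_form (qe_rcf.CcountGt0 sp sq).
Proof.
move=> rsp rsq; apply: rat_BigRgcd => // p rp; apply: rat_Isnull => // -[] /=.
  apply: rat_CcountWeak => //.
    apply: rat_Deriv; elim: sq rsq => //= q sq IH [rq rsq].
    by apply: rat_MulPoly => //; apply: IH.
  move=> t rt; split.
    by elim: sq rsq => //= q sq IH [rq rsq]; split; [apply: rat_LeadCoef|apply: IH].
  split=> //; elim: sq rsq => //= q sq IH [rq rsq]; split; last exact: IH.
  by apply: rat_Size => // n; apply: rat_LeadCoef.
by apply: rat_CcountWeak.
Qed.

Lemma rat_abstrX i t : rat_term t -> rat_poly (qe_rcf.abstrX i t).
Proof.
elim: t => //=.
- by move=> j _; case: ifP.
- by move=> u IHu v IHv [/IHu ru /IHv rv]; apply: rat_AddPoly.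
- by move=> u IH /IH; apply: rat_OppPoly.
- by move=> u IH n /IH; apply: rat_ScalPoly.
- by move=> u IHu v IHv [/IHu ru /IHv rv]; apply: rat_MulPoly.
- by move=> u IH n /IH; apply: rat_ExpPoly.
Qed.


Notation qev := (@qe_rcf.eval F).
Notation clause := (seq tF * seq tF)%type.

Let clause_holds e (c : clause) :=
  all (fun t => qev e t == 0) c.1 && all (fun t => 0 < qev e t) c.2.

Let rat_clause (c : clause) := rat_poly c.1 /\ rat_poly c.2.

Let dnf_of (X : seq F -> bool) := exists2 d : seq clause,
  each rat_clause d & forall e, X e = has (clause_holds e) d.

Let dnf_true : dnf_of (fun=> true).
Proof. by exists [:: ([::], [::])]. Qed.

Let dnf_false : dnf_of (fun=> false).
Proof. by exists [::]. Qed.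

Let dnf_or X Y : dnf_of X -> dnf_of Y -> dnf_of (fun e => X e || Y e).
Proof.
move=> [c rc XE] [d rd YE]; exists (c ++ d); first exact: each_cat.
by move=> e; rewrite has_cat XE YE.
Qed.

Let dnf_and X Y : dnf_of X -> dnf_of Y -> dnf_of (fun e => X e && Y e).
Proof.
move=> [c rc XE] [d rd YE].
exists [seq (a.1 ++ b.1, a.2 ++ b.2) | a <- c, b <- d].
  elim: c rc {XE} => //= a c IH [[ra1 ra2] /IH rc]; apply: each_cat => //.
  elim: d rd {YE IH rc} => //= b d IH [[rb1 rb2] /IH]; split=> //; split; exact: each_cat.
move=> e; rewrite XE YE; elim: c {rc XE} => //= a c IH; rewrite has_cat -IH andb_orl.
congr (_ || _); rewrite has_map; elim: d {rd YE IH} => [|b d IH] /=; first by rewrite andbF.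
by rewrite andb_orr IH /clause_holds !all_cat /=; congr (_ || _); rewrite andbACA.
Qed.

Let dnf_eq0 t : rat_term t -> dnf_of (fun e => qev e t == 0).
Proof. by exists [:: ([:: t], [::])] => // e; rewrite /clause_holds /= !andbT orbF. Qed.

Let dnf_gt0 t : rat_term t -> dnf_of (fun e => 0 < qev e t).
Proof. by exists [:: ([::], [:: t])] => // e; rewrite /clause_holds /= !andbT orbF. Qed.

Let dnf_ext X Y : (forall e, X e = Y e) -> dnf_of X -> dnf_of Y.
Proof. by move=> XY [d rd XE]; exists d => // e; rewrite -XY. Qed.

(* The negation is carried along because clauses are positive: a failing
equation is a disjunction of two strict inequalities. *)
Let dnf_form f : rat_form f ->
  dnf_of (fun e => qe_rcf.qf_eval e f) /\ dnf_of (fun e => ~~ qe_rcf.qf_eval e f).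
Proof.
have sub u v : rat_term u -> rat_term v -> rat_term (qe_rcf.Add u (qe_rcf.Opp v)) by [].
elim: f => [[]|u v|u v|u v|f IHf g IHg|f IHf g IHg|f IHf g IHg|f IHf] /=.
- by move=> _; split; [exact: dnf_true|exact: dnf_false].
- by move=> _; split; [exact: dnf_false|exact: dnf_true].
- move=> [ru rv]; split.
    apply: dnf_ext (dnf_eq0 (sub _ _ ru rv)) => e /=; exact: subr_eq0.
  apply: dnf_ext (dnf_or (dnf_gt0 (sub _ _ ru rv)) (dnf_gt0 (sub _ _ rv ru))) => e /=.
  by rewrite !subr_gt0 neq_lt orbC.
- move=> [ru rv]; split; first by apply: dnf_ext (dnf_gt0 (sub _ _ rv ru)) => e /=; exact: subr_gt0.
  apply: dnf_ext (dnf_or (dnf_gt0 (sub _ _ ru rv)) (dnf_eq0 (sub _ _ ru rv))) => e /=.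
  by rewrite subr_gt0 subr_eq0 -leNgt le_eqVlt orbC eq_sym.
- move=> [ru rv]; split; last by apply: dnf_ext (dnf_gt0 (sub _ _ ru rv)) => e /=; rewrite subr_gt0 ltNge.
  apply: dnf_ext (dnf_or (dnf_gt0 (sub _ _ rv ru)) (dnf_eq0 (sub _ _ rv ru))) => e /=.
  by rewrite subr_gt0 subr_eq0 le_eqVlt orbC eq_sym.
- move=> [/IHf[f1 f2] /IHg[g1 g2]]; split; first exact: dnf_and.
  by apply: dnf_ext (dnf_or f2 g2) => e; rewrite negb_and.
- move=> [/IHf[f1 f2] /IHg[g1 g2]]; split; first exact: dnf_or.
  by apply: dnf_ext (dnf_and f2 g2) => e; rewrite negb_or.
- move=> [/IHf[f1 f2] /IHg[g1 g2]]; split.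
    by apply: dnf_ext (dnf_or f2 g1) => e; rewrite implybE.
  by apply: dnf_ext (dnf_and f1 g2) => e; rewrite negb_imply.
- by move=> /IHf[f1 f2]; split=> //; apply: dnf_ext f1 => e; rewrite negbK.
Qed.

(** Semantic counterparts of formulas and terms: closure properties of these two
classes replace the construction of explicit formulas. *)
Definition rational_set (X : seq F -> Prop) := exists2 f : fF,
  rat_form f & forall e, X e <-> qe_rcf.qf_eval e f.

Definition rational_fun (g : seq F -> F) := exists2 t : tF,
  rat_term t & forall e, g e = qev e t.

Lemma rational_set_ext X Y : (forall e, X e <-> Y e) -> rational_set X -> rational_set Y.
Proof. by move=> XY [f rf XE]; exists f => // e; rewrite -XY. Qed.

Lemma rational_setT : rational_set (fun=> True).
Proof. by exists (qe_rcf.Bool true). Qed.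

Lemma rational_set_and X Y :
  rational_set X -> rational_set Y -> rational_set (fun e => X e /\ Y e).
Proof.
move=> [f rf XE] [g rg YE]; exists (qe_rcf.And f g) => // e.
by rewrite XE YE; split=> [/andP|/andP].
Qed.

Lemma rational_set_not X : rational_set X -> rational_set (fun e => ~ X e).
Proof.
move=> [f rf XE]; exists (qe_rcf.Not f) => // e.
by rewrite XE; split=> [/negP|/negP].
Qed.

Lemma rational_set_all (I : finType) (X : I -> seq F -> Prop) :
  (forall i, rational_set (X i)) -> rational_set (fun e => forall i, X i e).
Proof.
move=> rX; suff: rational_set (fun e => forall i, i \in enum I -> X i e).
  by apply: rational_set_ext => e; split=> [XI i|XI i _] //; apply: XI; rewrite mem_enum.
elim: (enum I) => [|i s IH]; first by apply: rational_set_ext rational_setT.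
apply: rational_set_ext (rational_set_and (rX i) IH) => e; split=> [[Xi Xs] j|Xs].
  by rewrite inE => /predU1P[->//|]; apply: Xs.
by split=> [|j js]; apply: Xs; rewrite inE ?eqxx ?js ?orbT.
Qed.

Lemma rational_set_eq g h : rational_fun g -> rational_fun h ->
  rational_set (fun e => g e = h e).
Proof.
move=> [t rt gE] [u ru hE]; exists (qe_rcf.Equal t u) => // e /=.
by rewrite gE hE; split=> [->|/eqP].
Qed.

Lemma rational_set_ge0 g : rational_fun g -> rational_set (fun e => 0 <= g e).
Proof. by move=> [t rt gE]; exists (qe_rcf.Le (qe_rcf.NatConst F 0) t) => // e /=; rewrite gE. Qed.

Lemma rational_fun_ext g h : g =1 h -> rational_fun g -> rational_fun h.
Proof. by move=> gh [t rt gE]; exists t => // e; rewrite -gh. Qed.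

Lemma rational_fun_var i : rational_fun (fun e => e`_i).
Proof. by exists (qe_rcf.Var F i). Qed.

Lemma rational_fun_const c : rational c -> rational_fun (fun=> c).
Proof. by exists (qe_rcf.Const c). Qed.

Lemma rational_funD g h : rational_fun g -> rational_fun h ->
  rational_fun (fun e => g e + h e).
Proof. by move=> [t rt gE] [u ru hE]; exists (qe_rcf.Add t u) => // e; rewrite gE hE. Qed.

Lemma rational_funM g h : rational_fun g -> rational_fun h ->
  rational_fun (fun e => g e * h e).
Proof. by move=> [t rt gE] [u ru hE]; exists (qe_rcf.Mul t u) => // e; rewrite gE hE. Qed.

Lemma rational_funN g : rational_fun g -> rational_fun (fun e => - g e).
Proof. by move=> [t rt gE]; exists (qe_rcf.Opp t) => // e; rewrite gE. Qed.

Lemma rational_fun_sum (I : Type) (s : seq I) (P : pred I) (g : I -> seq F -> F) :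
  (forall i, rational_fun (g i)) -> rational_fun (fun e => \sum_(i <- s | P i) g i e).
Proof.
move=> rg; elim: s => [|i s IH].
  by apply: rational_fun_ext (rational_fun_const rational0) => e; rewrite big_nil.
case Pi: (P i).
  by apply: rational_fun_ext (rational_funD (rg i) IH) => e; rewrite big_cons Pi.
by apply: rational_fun_ext IH => e; rewrite big_cons Pi.
Qed.

(** Tarski's theorem.  For each clause the quantifier is eliminated by counting,
with Sturm sequences, the roots of the equations at which the remaining
polynomials are positive. *)
Lemma rational_set_exists i X : rational_set X ->
  rational_set (fun e => exists x, X (set_nth 0 e i x)).
Proof.
move=> [f rf XE]; have [[d rd dE] _] := dnf_form rf.
pose elim_clause (c : clause) :=
  qe_rcf.CcountGt0 (map (qe_rcf.abstrX i) c.1) (map (qe_rcf.abstrX i) c.2).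
have elimE c e : qe_rcf.qf_eval e (elim_clause c) <->
    exists x, clause_holds (set_nth 0 e i x) c.
  have -> : qe_rcf.qf_eval e (elim_clause c) <-> qe_rcf_th.ccount_gt0
      (map (qe_rcf.eval_poly e) (map (qe_rcf.abstrX i) c.1))
      (map (qe_rcf.eval_poly e) (map (qe_rcf.abstrX i) c.2)).
    by rewrite qe_rcf.eval_CcountGt0.
  rewrite -(rwP (qe_rcf_th.ccount_gt0P _ _)).
  have E x : clause_holds (set_nth 0 e i x) c =
      \big[andb/true]_(p <- map (qe_rcf.eval_poly e) (map (qe_rcf.abstrX i) c.1)) (p.[x] == 0)
      && \big[andb/true]_(q <- map (qe_rcf.eval_poly e) (map (qe_rcf.abstrX i) c.2)) (0 < q.[x]).
    rewrite !big_map !big_all /clause_holds; congr (_ && _);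
    by apply: eq_all => t; rewrite qe_rcf.abstrXP.
  by split=> -[x]; rewrite ?E => Hx; exists x; rewrite ?E.
exists (foldr (@qe_rcf.Or F) (qe_rcf.Bool false) (map elim_clause d)).
  elim: d rd {dE} => //= c d IH [[rc1 rc2] /IH rd]; split=> //.
  by apply: rat_CcountGt0; apply: each_map (@rat_abstrX i) _.
move=> e; transitivity (exists x, has (clause_holds (set_nth 0 e i x)) d).
  by split=> -[x]; [rewrite XE dE|rewrite -dE -XE] => Hx; exists x.
elim: d {rd dE} => [|c d IH] /=; first by split=> // -[].
split=> [[x /orP[cx|dx]]|/orP[/elimE[x cx]|/IH[x dx]]].
- by apply/orP; left; apply/elimE; exists x.
- by apply/orP; right; apply/IH; exists x.
- by exists x; rewrite cx.
- by exists x; rewrite dx orbT.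
Qed.

Lemma rational_set_nth X e e' : rational_set X -> (forall i, e`_i = e'`_i) -> X e -> X e'.
Proof.
move=> [f _ XE] ee'; rewrite !XE.
have evE t : qev e t = qev e' t by elim: t => //= [u -> v ->|u ->|u -> n|u -> v ->|u -> n].
suff -> : qe_rcf.qf_eval e f = qe_rcf.qf_eval e' f by [].
by elim: f {XE} => //= [u v|u v|u v|f -> g ->|f -> g ->|f -> g ->|f ->]; rewrite ?evE.
Qed.

(** Elimination of a block of [k] consecutive variables, which is what a
quantifier over matrices amounts to. *)
Lemma rational_set_exists_range m k X : rational_set X ->
  rational_set (fun e => exists2 e' : seq F, X e' &
    forall i, ~~ (m <= i < m + k)%N -> e'`_i = e`_i).
Proof.
move=> rX; elim: k => [|k IH].
  apply: rational_set_ext (rX) => e; split=> [Xe|[e' Xe' ee']]; first by exists e.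
  by apply: (rational_set_nth rX) Xe' => i; apply: ee'; rewrite addn0; case: ltngtP.
apply: rational_set_ext (rational_set_exists (m + k) IH) => e; split.
  move=> [x [e' Xe' ee']]; exists e' => // i im; rewrite ee'.
    by rewrite nth_set_nth /= ifN //; apply: contraNneq im => ->; lia.
  by apply: contraNN im => /andP[-> im]; rewrite addnS ltnS ltnW.
move=> [e' Xe' ee']; exists e'`_(m + k), e' => // i im; rewrite nth_set_nth /=.
case: eqP => [->//|imk]; apply: ee'; apply: contraNN im; lia.
Qed.

End RationalQE.

(** * Real matrices *)

Fixpoint word (R : pzSemiRingType) n (I : Type) (A : I -> 'M[R]_n) (w : seq I) :=
  if w is i :: w' then A i *m word A w' else 1%:M.

Section RealMatrices.
Variable F : rcfType.

Lemma mxtrace_trmx_mul_ge0 m n (X : 'M[F]_(m, n)) : 0 <= \tr (X *m X^T).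
Proof.
by apply: sumr_ge0 => i _; rewrite mxE; apply: sumr_ge0 => j _; rewrite !mxE -expr2 sqr_ge0.
Qed.

(** Positivity of the trace form: this is where the order of [F] enters the
linear algebra. *)
Lemma mxtrace_trmx_mul_eq0 m n (X : 'M[F]_(m, n)) : \tr (X *m X^T) = 0 -> X = 0.
Proof.
move/eqP; rewrite psumr_eq0 => [/allP X0|i _]; last first.
  by rewrite mxE; apply: sumr_ge0 => j _; rewrite !mxE -expr2 sqr_ge0.
apply/matrixP => i j; rewrite mxE; have := X0 i (mem_index_enum _).
rewrite mxE psumr_eq0 => [/allP /(_ j (mem_index_enum _))|k _].
  by rewrite !mxE mulf_eq0 orbb => /eqP.
by rewrite !mxE -expr2 sqr_ge0.
Qed.

Lemma sym_mx_square_eq0 n (X : 'M[F]_n) : X^T = X -> X *m X = 0 -> X = 0.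
Proof. by move=> Xs X2; apply: mxtrace_trmx_mul_eq0; rewrite Xs X2 mxtrace0. Qed.

(** A real symmetric matrix is Hermitian over [F(sqrt -1)], hence diagonalizable
there with real eigenvalues; these cannot all vanish unless the matrix does. *)
Lemma sym_mx_eigenvalue n (S : 'M[F]_n) :
  S^T = S -> S != 0 -> exists2 l, l != 0 & eigenvalue S l.
Proof.
move=> Ss Sn0; pose f := real_complex F; pose A := map_mx f S.
have Ah : A \is hermsymmx.
  apply: realsym_hermsym.
    apply/is_hermitianmxP; rewrite expr0 scale1r map_mx_id //.
    by apply/matrixP => i j; rewrite !mxE -{1}Ss mxE.
  by apply/mxOverP => i j; rewrite mxE complex_real.
have An : A \is normalmx by exact: hermitian_normalmx.
have Ad := orthomx_spectralP An.
set P := spectralmx A in Ad; set d := spectral_diag A in Ad.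
have Pu : P \in unitmx by exact: spectral_unit.
have [i di] : exists i, d 0 i != 0.
  apply/existsP; apply: contraNT Sn0; rewrite negb_exists => /forallP d0.
  rewrite -(map_mx_eq0 f) -/A Ad (_ : d = 0).
    by rewrite linear0 mulmx0 mul0mx.
  by apply/rowP => j; rewrite mxE; apply/eqP; rewrite -[_ == _]negbK.
have dr : d 0 i \is Num.real.
  by have /mxOverP := hermitian_spectral_diag_real Ah; apply.
have [l dl] : exists l, d 0 i = f l by exact/complex_realP.
exists l; first by move: di; rewrite dl fmorph_eq0.
rewrite -(eigenvalue_map f) -[X in eigenvalue _ X]/(f l) -dl -/A; apply/eigenvalueP; exists (row i P).
  rewrite -row_mul {1}Ad !mulmxA mulmxV // mul1mx mul_diag_mx.
  by apply/rowP => j; rewrite !mxE.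
apply: contraTneq Pu => Pi0; rewrite -row_free_unit; apply/negP => /row_freeP[Q PQ].
have : row i (1%:M : 'M[F[i]]_n) = 0 by rewrite -PQ row_mul Pi0 mul0mx.
by move/rowP/(_ i); rewrite !mxE eqxx => /eqP; rewrite oner_eq0.
Qed.

(** The projection onto an eigenspace is a polynomial in [S], namely the quotient
[g] of the minimal polynomial by ['X - l], up to a scalar; hence it commutes with
whatever commutes with [S].  Since [g(S)] is symmetric, [g(S) ^+ 2 = g(l) g(S)]
does not vanish, so [g(l)] can be inverted. *)
Lemma sym_mx_spectral_idempotent n (S : 'M[F]_n) : S^T = S -> S != 0 ->
  exists (l : F) (p : 'M[F]_n), [/\ l != 0, p != 0, p^T = p, p *m p = p & S *m p = l *: p] /\
    forall X, S *m X = X *m S -> p *m X = X *m p.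
Proof.
case: n S => [S _ /eqP[]|n S Ss Sn0]; first by rewrite [S]flatmx0.
have [l l0 /[!eigenvalue_root_min] rl] := sym_mx_eigenvalue Ss Sn0.
have [g mE] := factor_theorem _ _ rl.
have gn0 : g != 0.
  apply: contraTneq (mxminpoly_nonconstant S) => g0.
  by have := size_mxminpoly S; rewrite mE g0 mul0r size_poly0.
pose p0 := horner_mx S g.
have p0n0 : p0 != 0.
  apply/eqP => /mxminpoly_min /(dvdp_leq gn0).
  by rewrite mE size_Mmonic ?monicXsubC // size_XsubC addn2 ltnn.
have Sp0 : S *m p0 = l *: p0.
  have := mx_root_minpoly S; rewrite mE mulrC rmorphM rmorphB /= horner_mx_X horner_mx_C.
  by rewrite -mulmxE mulmxBl mul_scalar_mx => /eqP; rewrite subr_eq0 => /eqP.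
have fp0 (f : {poly F}) : horner_mx S f *m p0 = f.[l] *: p0.
  elim/poly_ind: f => [|f c IH]; first by rewrite rmorph0 mul0mx horner0 scale0r.
  rewrite rmorphD rmorphM /= horner_mx_X horner_mx_C hornerMXaddC mulmxDl -mulmxA.
  by rewrite Sp0 -scalemxAr IH mul_scalar_mx scalerA mulrC -scalerDl.
have p0s : p0^T = p0.
  rewrite /p0; elim/poly_ind: (g) => [|f c IH]; first by rewrite !rmorph0 trmx0.
  rewrite rmorphD rmorphM /= horner_mx_X horner_mx_C linearD /= tr_scalar_mx -mulmxE.
  by rewrite trmx_mul Ss IH comm_mx_horner.
have gl0 : g.[l] != 0.
  apply: contraNneq p0n0 => gl0; apply/eqP/sym_mx_square_eq0 => //.
  by rewrite -/p0 fp0 gl0 scale0r.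
exists l, (g.[l]^-1 *: p0); split.
  split=> //.
  - by rewrite scaler_eq0 invr_eq0 (negPf gl0).
  - by rewrite linearZ /= p0s.
  - by rewrite -scalemxAl -scalemxAr fp0 (scalerA _ g.[l]) mulVf // scale1r.
  - by rewrite -scalemxAr Sp0 !scalerA mulrC.
by move=> X SX; rewrite -scalemxAl -scalemxAr /p0 comm_horner_mx.
Qed.

(** A matrix of maximal rank with rows in the subspace [V] spans it; the
induction is on the codimension of what is spanned already. *)
Lemma subspace_row_base m (V : 'rV[F]_m -> Prop) :
  V 0 -> (forall a u v, V u -> V v -> V (a *: u + v)) ->
  exists k (B : 'M[F]_(k, m)), row_free B /\ forall v, V v <-> (v <= B)%MS.
Proof.
move=> V0 Vlin.
have [k [B [VB BV]]] : exists k (B : 'M[F]_(k, m)),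
    (forall i, V (row i B)) /\ forall v, V v -> (v <= B)%MS.
  suff H c : forall k (B : 'M[F]_(k, m)), (forall i, V (row i B)) ->
      (m - \rank B <= c)%N -> exists k (B : 'M[F]_(k, m)),
      (forall i, V (row i B)) /\ forall v, V v -> (v <= B)%MS.
    by apply: (H m 0 0) => [[]//|]; rewrite leq_subr.
  elim: c => [|c IH] k B VB.
    rewrite leqn0 subn_eq0 => rB; exists k, B; split=> // v _.
    by apply: submx_full; rewrite /row_full eqn_leq rank_leq_col.
  move=> rB; have [all|/not_all_ex_not[v vP]] := classic (forall v, V v -> (v <= B)%MS).
    by exists k, B.
  have [Vv vB] : V v /\ ~ (v <= B)%MS by apply: imply_to_and.
  apply: (IH _ (col_mx B v)) => [i|].
    rewrite -(splitK i); case: (split i) => j /=; first by rewrite rowKu.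
    by rewrite rowKd row_id.
  have : (\rank B < \rank (col_mx B v))%N.
    apply: rank_ltmx; rewrite /ltmx col_mx_sub submx_refl /= -addsmxE addsmxSl /=.
    by apply/negP.
  by move: rB; lia.
have row_sub v : (v <= B)%MS -> V v.
  case/submxP => D ->; rewrite mulmx_sum_row.
  by elim/big_rec: _ => // i x _ Vx; apply: Vlin.
exists _, (row_base B); split=> [|v]; first exact: row_base_free.
by rewrite eq_row_base; split; [exact: BV|exact: row_sub].
Qed.

(** ** The double commutant theorem *)

Section Bicommutant.
Variables (K : nat) (A : 'M[F]_K -> Prop).
Hypothesis A1 : A 1%:M.
Hypothesis Alin : forall a x y, A x -> A y -> A (a *: x + y).
Hypothesis Amul : forall x y, A x -> A y -> A (x *m y).
Hypothesis Atr : forall x, A x -> A x^T.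

(** The orthogonal projection onto the row space of [B] is
[B^T (B B^T)^-1 B]. *)
Lemma orthogonal_projection : exists f : {linear 'M[F]_K -> 'M[F]_K},
  [/\ forall y, A (f y), forall x, A x -> f x = x &
      forall y, (forall x, A x -> \tr (y *m x^T) = 0) -> f y = 0] /\
  (forall y x, A x -> \tr ((y - f y) *m x^T) = 0).
Proof.
have mxv (x y : 'M[F]_K) : \tr (x *m y^T) = (mxvec x *m (mxvec y)^T) 0 0.
  rewrite mxE /mxtrace (reindex _ (curry_mxvec_bij _ _)) /=.
  under eq_bigr do rewrite mxE; rewrite pair_bigA /=.
  by apply: eq_bigr => -[i j] _; rewrite !mxE /= !mxvecE.
have [| |k [B [Bf BP]]] := @subspace_row_base (K * K) (fun v => A (vec_mx v)).
- by have := Alin (-1) A1 A1; rewrite scaleN1r addNr linear0.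
- by move=> a u v Au Av; rewrite linearP; apply: Alin.
pose G := B *m B^T.
have Gu : G \in unitmx.
  rewrite -row_free_unit -kermx_eq0; apply/eqP/row_matrixP => i; rewrite row0.
  set v := row i _; have vG : v *m G = 0 by rewrite -row_mul mulmx_ker row0.
  have vB : v *m B = 0.
    apply: mxtrace_trmx_mul_eq0.
    by rewrite trmx_mul mulmxA -(mulmxA v) vG mul0mx mxtrace0.
  by apply: (row_free_inj Bf); rewrite vB mul0mx.
pose P := B^T *m invmx G *m B.
have fl : linear (fun y : 'M[F]_K => vec_mx (mxvec y *m P)).
  by move=> a x y; rewrite linearP mulmxDl -scalemxAl linearP.
pose f : {linear 'M[F]_K -> 'M[F]_K} := HB.pack (fun y : 'M[F]_K => vec_mx (mxvec y *m P))
   (GRing.isLinear.Build _ _ _ _ _ fl).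
have fE y : f y = vec_mx (mxvec y *m P) by [].
have BtP : B *m P = B by rewrite /P !mulmxA mulmxV // mul1mx.
have PBt : P *m B^T = B^T by rewrite /P -mulmxA -/G mulmxKV.
exists f; split; first split.
- by move=> y; rewrite fE; apply/BP; rewrite /P mulmxA submxMl.
- move=> x Ax; have /submxP[D xD] : (mxvec x <= B)%MS by apply/BP; rewrite mxvecK.
  by rewrite fE xD -mulmxA BtP -xD mxvecK.
- move=> y yA; rewrite fE /P !mulmxA (_ : mxvec y *m B^T = 0) ?mul0mx ?linear0 //.
  apply/rowP => j; rewrite mxE [RHS]mxE.
  have /yA : A (vec_mx (row j B)) by apply/BP/row_sub.
  by rewrite mxv vec_mxK !mxE => {2}<-; apply: eq_bigr => i _; rewrite !mxE.
- move=> y x Ax; have /submxP[D xD] : (mxvec x <= B)%MS by apply/BP; rewrite mxvecK.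
  rewrite mxv fE raddfB /= vec_mxK xD trmx_mul mulmxA mulmxBl -(mulmxA _ P) PBt subrr.
  by rewrite mul0mx mxE.
Qed.

(** Let [f] be the orthogonal projection of the space of matrices onto [A]; as
[A] is closed under products and transposition, [f] commutes with left
multiplication by elements of [A].  Restricting [f] to matrices supported on
column [b] and reading column [a] of the result gives a matrix [T a b] in the
commutant of [A].  If [e] commutes with all of these, then left multiplication by
[e] commutes with [f], and [e = e *m f 1 = f e] lies in [A]. *)
Lemma bicommutant e :
  (forall T, (forall x, A x -> x *m T = T *m x) -> e *m T = T *m e) -> A e.
Proof.
move=> eT; have [f [[fA fid f0] fperp]] := orthogonal_projection.
have fmul x y : A x -> f (x *m y) = x *m f y.
  move=> Ax; apply/eqP; rewrite -subr_eq0; apply/eqP.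
  rewrite -{1}[y](subrK (f y)) mulmxDr linearD /= (fid (x *m f y)); last exact: Amul.
  rewrite addrK; apply: f0 => z Az.
  rewrite mxtrace_mulC mulmxA mxtrace_mulC.
  by rewrite -[z^T *m x]trmxK trmx_mul trmxK fperp //; apply: Amul => //; apply: Atr.
pose T a b : 'M[F]_K := \matrix_(i, j) f (delta_mx j b) i a.
have xT x a b i j : (x *m T a b) i j = (x *m f (delta_mx j b)) i a.
  by rewrite !mxE; apply: eq_bigr => k _; rewrite !mxE.
have Tx x a b i j : (T a b *m x) i j = f (x *m delta_mx j b) i a.
  have -> : x *m delta_mx j b = \sum_k x k j *: delta_mx k b.
    apply/matrixP => r s; rewrite !mxE summxE (bigD1 j) //= big1 => [|k /negPf kj].
      rewrite (bigD1 r) //= big1 => [|k /negPf kr]; first by rewrite !mxE !eqxx !addr0 andTb.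
      by rewrite !mxE eq_sym kr mulr0.
    by rewrite !mxE kj mulr0.
  rewrite linear_sum summxE !mxE; apply: eq_bigr => k _.
  by rewrite linearZ !mxE mulrC.
have ef j b : e *m f (delta_mx j b) = f (e *m delta_mx j b).
  apply/matrixP => i a; rewrite -xT -Tx eT // => x Ax.
  by apply/matrixP => r s; rewrite xT Tx fmul.
suff -> : e = f e by apply: fA.
have : e *m f 1%:M = f (e *m 1%:M).
  rewrite mx1_sum_delta !linear_sum.
  by apply: eq_bigr => j _; exact: ef.
by rewrite mulmx1 fid // mulmx1.
Qed.

End Bicommutant.

(** ** Unitary equivalence of transpose-closed families *)

(** The unital algebra generated by [G], described as the span of the words in
[G]: multiplication by a generator on the left only makes inductions short. *)
Inductive unital_span K (G : 'M[F]_K -> Prop) : 'M[F]_K -> Prop :=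
| unital_span1 : unital_span G 1%:M
| unital_spanM g x : G g -> unital_span G x -> unital_span G (g *m x)
| unital_span_lin a x y :
    unital_span G x -> unital_span G y -> unital_span G (a *: x + y).

Lemma unital_span_mul K (G : 'M[F]_K -> Prop) x y :
  unital_span G x -> unital_span G y -> unital_span G (x *m y).
Proof.
move=> Gx Gy; elim: Gx => [|g {}x Gg _ IH|a {}x z _ IHx _ IHz].
- by rewrite mul1mx.
- by rewrite -mulmxA; apply: unital_spanM.
- by rewrite mulmxDl -scalemxAl; apply: unital_span_lin.
Qed.

Lemma unital_span_gen K (G : 'M[F]_K -> Prop) x : G x -> unital_span G x.
Proof. by move=> Gx; rewrite -[x]mulmx1; apply: unital_spanM => //; exact: unital_span1. Qed.

Lemma unital_span_tr K (G : 'M[F]_K -> Prop) x :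
  (forall g, G g -> G g^T) -> unital_span G x -> unital_span G x^T.
Proof.
move=> Gt; elim=> [|g {}x Gg _ IH|a {}x z _ IHx _ IHz].
- by rewrite trmx1; apply: unital_span1.
- by rewrite trmx_mul; apply: unital_span_mul => //; apply/unital_span_gen/Gt.
- by rewrite linearP; apply: unital_span_lin.
Qed.

Lemma bicommutant_gen K (G : 'M[F]_K -> Prop) e :
  (forall g, G g -> G g^T) ->
  (forall T, (forall g, G g -> g *m T = T *m g) -> e *m T = T *m e) ->
  unital_span G e.
Proof.
move=> Gt eT; apply: bicommutant => [|a x y|x y|x|T GT].
- exact: unital_span1.
- exact: unital_span_lin.
- exact: unital_span_mul.
- exact: unital_span_tr.
- by apply: eT => g Gg; apply/GT/unital_span_gen.
Qed.

Section Specht.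
Variables (N : nat) (I : Type) (A B : I -> 'M[F]_N) (s : I -> I).
Hypotheses (As : forall i, A (s i) = (A i)^T) (Bs : forall i, B (s i) = (B i)^T).

Lemma word_block w : word (fun i => block_mx (A i) 0 0 (B i)) w =
  block_mx (word A w) 0 0 (word B w).
Proof.
elim: w => [|i w /= ->]; first by rewrite -scalar_mx_block.
by rewrite mulmx_block !mulmx0 !mul0mx !addr0 !add0r.
Qed.

(** Otherwise every matrix commuting with all [A_i + B_i] (block sums) and with
[P = p + q] commutes with [p + 0], which by the double commutant theorem belongs
to the algebra generated by these.  But on that algebra, cut down by [P], the two
blocks have the same trace, so [\tr p = 0] and [p = 0]. *)
Lemma nonzero_intertwiner p q : p^T = p -> q^T = q -> p *m p = p -> q *m q = q ->
    (forall i, A i *m p = p *m A i) -> (forall i, B i *m q = q *m B i) ->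
    (forall w, \tr (word A w *m p) = \tr (word B w *m q)) -> p != 0 ->
  exists T : 'M[F]_N, [/\ T != 0, q *m T *m p = T & forall i, T *m A i = B i *m T].
Proof.
move=> pt qt pp qq Ap Bq tAB p0; apply: NNPP => noT.
have T0 T : (forall i, T *m A i = B i *m T) -> q *m T *m p = 0.
  move=> TA; apply/eqP; apply: contra_notT noT => qTp; exists (q *m T *m p); split=> //.
    by rewrite !mulmxA qq -[LHS]mulmxA pp.
  by move=> i; rewrite -mulmxA -Ap !mulmxA -(mulmxA q) TA Bq !mulmxA.
pose C i := block_mx (A i) 0 0 (B i); pose P := block_mx p 0 0 q.
pose G x := x = P \/ exists i, x = C i.
have PP : P *m P = P by rewrite mulmx_block !mulmx0 !mul0mx !addr0 !add0r pp qq.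
have PC i : C i *m P = P *m C i.
  by rewrite !mulmx_block !mulmx0 !mul0mx !addr0 !add0r Ap Bq.
have Pspan x : unital_span G x -> x *m P = P *m x.
  elim=> [|g {}x [->|[i ->]] _ IH|a {}x z _ IHx _ IHz]; first by rewrite mul1mx mulmx1.
  - by rewrite -mulmxA IH.
  - by rewrite -mulmxA IH !mulmxA PC.
  - by rewrite mulmxDl mulmxDr -scalemxAl -scalemxAr IHx IHz.
pose tau (x : 'M[F]_(N + N)) := \tr (ulsubmx x) - \tr (drsubmx x).
have tauP a x y : tau (a *: x + y) = a * tau x + tau y.
  rewrite /tau /ulsubmx /drsubmx !linearP /= opprD addrACA mulrBr.
  by rewrite -!mxtraceZ.
have tauspan x : unital_span G x -> forall w, tau (word C w *m x *m P) = 0.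
  elim=> [w|g {}x [->|[i ->]] Gx IH w|a {}x z _ IHx _ IHz w].
  - rewrite /tau mulmx1 word_block mulmx_block !mulmx0 !mul0mx !addr0 !add0r.
    by rewrite block_mxKul block_mxKdr tAB subrr.
  - by rewrite -!mulmxA Pspan // (mulmxA P) PP -Pspan // mulmxA IH.
  - rewrite mulmxA -[C i]mulmx1.
    have := IH (rcons w i); congr (tau (_ *m _ *m _) = _).
    elim: w => [|j w IHw] /=; first by rewrite mul1mx !mulmx1.
    by rewrite IHw !mulmxA.
  - by rewrite mulmxDr mulmxDl -scalemxAr -scalemxAl tauP IHx IHz mulr0 addr0.
have eG : unital_span G (block_mx p 0 0 0).
  apply: bicommutant_gen => [g [->|[i ->]]|T GT].
  - by left; rewrite tr_block_mx !trmx0 pt qt.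
  - by right; exists (s i); rewrite tr_block_mx !trmx0 /C As Bs.
  have TP := GT P (or_introl erefl).
  have TC i := GT (C i) (or_intror (ex_intro _ i erefl)).
  move: TP TC; rewrite -(submxK T).
  set T11 := ulsubmx T; set T12 := ursubmx T; set T21 := dlsubmx T; set T22 := drsubmx T.
  rewrite !mulmx_block !mulmx0 !mul0mx !addr0 !add0r => /eq_block_mx[T11p T12p T21p T22p] TC.
  have T21A : q *m T21 *m p = 0.
    apply: T0 => i; move: (TC i); rewrite !mulmx_block !mulmx0 !mul0mx !addr0 !add0r.
    by case/eq_block_mx.
  have T12A : q *m T12^T *m p = 0.
    apply: T0 => i; move: (TC (s i)); rewrite !mulmx_block !mulmx0 !mul0mx !addr0 !add0r.
    case/eq_block_mx => _ /(congr1 trmx) + _ _.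
    by rewrite !trmx_mul As Bs !trmxK.
  have T12z : p *m T12 = 0.
    rewrite -pp -mulmxA T12p mulmxA; apply: trmx_inj.
    by rewrite trmx0 !trmx_mul pt qt mulmxA.
  have T21z : T21 *m p = 0 by rewrite -T21p -qq -mulmxA T21p mulmxA T21A.
  by rewrite T12z T21z T11p.
have := tauspan _ eG [::]; rewrite mul1mx mulmx_block !mulmx0 !mul0mx !addr0.
rewrite /tau block_mxKul block_mxKdr mxtrace0 subr0 -{2}pt => /mxtrace_trmx_mul_eq0 p00.
by rewrite p00 eqxx in p0.
Qed.

(** The induction hypothesis is about the orthogonal projections [p] and [q] on
what remains to be matched.  If [T] is a nonzero intertwiner and [p1] the
projection on an eigenspace of [T^T *m T] for [l != 0], then [l > 0] and
[u1 = T *m p1 / sqrt l] is a partial isometry from [p1] to [q1 = u1 *m u1^T], by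
which the traces cut down by [p1] and by [q1] agree. *)
Lemma partial_isometry p q : p^T = p -> q^T = q -> p *m p = p -> q *m q = q ->
    (forall i, A i *m p = p *m A i) -> (forall i, B i *m q = q *m B i) ->
    (forall w, \tr (word A w *m p) = \tr (word B w *m q)) ->
  exists u : 'M[F]_N, [/\ u^T *m u = p, u *m u^T = q & forall i, u *m A i = B i *m u].
Proof.
have [r] := ubnP (\rank p); elim: r p q => // r IH p q rp pt qt pp qq Ap Bq tAB.
have [p0|p0] := eqVneq p 0.
  exists 0; split=> [||i]; rewrite ?trmx0 ?mulmx0 ?mul0mx ?p0 //.
  apply/esym; apply: mxtrace_trmx_mul_eq0; rewrite qt qq.
  by have /= := tAB [::]; rewrite !mul1mx p0 mxtrace0.
have [T [T0 qTp TA]] := nonzero_intertwiner pt qt pp qq Ap Bq tAB p0.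
have Tp : T *m p = T by rewrite -qTp -[LHS]mulmxA pp.
have qT : q *m T = T by rewrite -qTp !mulmxA qq.
pose S := T^T *m T.
have St : S^T = S by rewrite trmx_mul trmxK.
have S0 : S != 0.
  apply: contraNneq T0 => S0; apply/eqP/trmx_inj; rewrite trmx0.
  by apply: mxtrace_trmx_mul_eq0; rewrite trmxK -/S S0 mxtrace0.
have TtB i : T^T *m B i = A i *m T^T.
  have := congr1 trmx (TA (s i)); rewrite !trmx_mul As Bs !trmxK => <-//.
have SA i : S *m A i = A i *m S by rewrite -mulmxA TA mulmxA TtB mulmxA.
have pTt : p *m T^T = T^T by rewrite -[in RHS]Tp trmx_mul pt.
have Sp : S *m p = p *m S by rewrite -mulmxA Tp mulmxA pTt.
have [l [p1 [[l0 p10 p1t p1p1 Sp1] p1c]]] := sym_mx_spectral_idempotent St S0.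
have p1A i : p1 *m A i = A i *m p1 by apply: p1c.
have pp1 : p *m p1 = p1.
  by apply: (scalerI l0); rewrite scalemxAr -Sp1 mulmxA mulmxA pTt.
have p1p : p1 *m p = p1 by rewrite p1c // pp1.
have trp1 : 0 < \tr p1.
  have := mxtrace_trmx_mul_ge0 p1; rewrite p1t p1p1 le_eqVlt => /orP[/eqP tr0|//].
  have := @mxtrace_trmx_mul_eq0 _ _ p1; rewrite p1t p1p1 -tr0 => /(_ erefl) p10'.
  by rewrite p10' eqxx in p10.
have lp : 0 < l.
  rewrite lt_def l0 /= -(pmulr_lge0 _ trp1) -mxtraceZ -Sp1 -p1p1 mulmxA mxtrace_mulC.
  have := mxtrace_trmx_mul_ge0 (p1 *m T^T).
  by rewrite trmx_mul trmxK p1t !mulmxA -[X in X *m p1]mulmxA.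
have cT (c : F) : (c *: (T *m p1))^T = c *: (p1 *m T^T).
  by rewrite linearZ /= trmx_mul p1t.
have [u1 [u1u1 u1p1 u1A qu1]] : exists u1 : 'M[F]_N, [/\ u1^T *m u1 = p1,
    u1 *m p1 = u1, forall i, u1 *m A i = B i *m u1 & q *m u1 = u1].
  exists ((Num.sqrt l)^-1 *: (T *m p1)).
  split=> [||i|].
  - rewrite cT -scalemxAl -scalemxAr scalerA !mulmxA.
    rewrite -[X in X *m p1]mulmxA -/S -mulmxA Sp1 -scalemxAr scalerA p1p1.
    by rewrite -invfM -expr2 sqr_sqrtr ?ltW // mulVf // scale1r.
  - by rewrite -scalemxAl -mulmxA p1p1.
  - by rewrite -scalemxAl -scalemxAr -mulmxA p1A mulmxA TA mulmxA.
  - by rewrite -scalemxAr mulmxA qT.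
pose q1 : 'M[F]_N := u1 *m u1^T.
have u1tB i : u1^T *m B i = A i *m u1^T.
  by have := congr1 trmx (u1A (s i)); rewrite !trmx_mul As Bs !trmxK => <-.
have u1tq : u1^T *m q = u1^T by rewrite -{2}qu1 trmx_mul qt.
have q1t : q1^T = q1 by rewrite trmx_mul trmxK.
have q1q1 : q1 *m q1 = q1.
  by rewrite /q1 mulmxA -[X in X *m _]mulmxA u1u1 u1p1.
have qq1 : q *m q1 = q1 by rewrite mulmxA qu1.
have q1q : q1 *m q = q1 by rewrite -mulmxA u1tq.
have q1B i : B i *m q1 = q1 *m B i by rewrite /q1 mulmxA -u1A -!mulmxA u1tB.
have u1w w : u1 *m word A w = word B w *m u1.
  elim: w => [|i w IHw] /=; first by rewrite mulmx1 mul1mx.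
  by rewrite mulmxA u1A -[LHS]mulmxA IHw mulmxA.
have trq w : \tr (word A w *m p1) = \tr (word B w *m q1).
  by rewrite /q1 mulmxA -u1w [RHS]mxtrace_mulC mulmxA u1u1 mxtrace_mulC.
have [||||||||u [uu uut uA]] := IH (p - p1) (q - q1).
- rewrite ltnS in rp; apply: leq_trans rp; apply: rank_ltmx; apply/andP; split.
    by apply/submxP; exists (p - p1); rewrite mulmxBl pp p1p.
  have p1_le : (p1 <= p)%MS by apply/submxP; exists p1; rewrite p1p.
  apply: contra p10 => /(submx_trans p1_le).
  by case/submxP => X p1X; rewrite -p1p1 {1}p1X -mulmxA mulmxBl pp1 p1p1 subrr mulmx0.
- by rewrite linearB /= pt p1t.
- by rewrite linearB /= qt q1t.
- by rewrite mulmxBl !mulmxBr pp pp1 p1p p1p1 subrr subr0.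
- by rewrite mulmxBl !mulmxBr qq qq1 q1q q1q1 subrr subr0.
- by move=> i; rewrite mulmxBl mulmxBr Ap p1A.
- by move=> i; rewrite mulmxBl mulmxBr Bq q1B.
- by move=> w; rewrite !mulmxBr !linearB /= tAB; congr (_ - _); exact: trq.
have u1u : u1^T *m u = 0.
  apply: mxtrace_trmx_mul_eq0; rewrite trmx_mul trmxK mulmxA -(mulmxA _ u) uut.
  by rewrite mulmxBr u1tq mulmxA u1u1 -{1}u1p1 trmx_mul p1t subrr mul0mx mxtrace0.
have uu1 : u1 *m u^T = 0.
  apply: mxtrace_trmx_mul_eq0; rewrite trmx_mul trmxK mulmxA -(mulmxA _ u^T) uu.
  by rewrite mulmxBr -{1}u1p1 -mulmxA p1p u1p1 subrr mul0mx mxtrace0.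
have uD : (u1 + u)^T = u1^T + u^T by rewrite linearD.
have uu1t : u^T *m u1 = 0 by rewrite -[LHS]trmxK trmx_mul trmxK u1u trmx0.
have u1ut : u *m u1^T = 0 by rewrite -[LHS]trmxK trmx_mul trmxK uu1 trmx0.
exists (u1 + u); split=> [||i].
- by rewrite uD mulmxDl !mulmxDr u1u1 u1u uu uu1t addr0 add0r addrC subrK.
- by rewrite uD mulmxDl !mulmxDr uu1 uut u1ut addr0 add0r addrC subrK.
- by rewrite mulmxDl mulmxDr u1A uA.
Qed.

End Specht.

(** Specht's criterion for simultaneous orthogonal equivalence, over a real closed
field. *)
Theorem specht N (I : Type) (A B : I -> 'M[F]_N) (s : I -> I) :
    (forall i, A (s i) = (A i)^T) -> (forall i, B (s i) = (B i)^T) ->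
    (forall w, \tr (word A w) = \tr (word B w)) ->
  exists u : 'M[F]_N, [/\ u^T *m u = 1%:M, u *m u^T = 1%:M & forall i, u *m A i = B i *m u].
Proof.
move=> As Bs tAB; apply: partial_isometry As Bs _ _ _ _ _ _ _ _ _.
- exact: trmx1.
- exact: trmx1.
- exact: mulmx1.
- exact: mulmx1.
- by move=> i; rewrite mul1mx mulmx1.
- by move=> i; rewrite mul1mx mulmx1.
- by move=> w; rewrite !mulmx1.
Qed.

(** ** Words of bounded length *)

Inductive word_span K (I : Type) (C : I -> 'M[F]_K) l : 'M[F]_K -> Prop :=
| word_span0 : word_span C l 0
| word_span_lin a w x : (size w <= l)%N -> word_span C l x ->
    word_span C l (a *: word C w + x).

Section BoundedWords.
Variables (K : nat) (I : Type) (C : I -> 'M[F]_K).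

Lemma word_spanP l a x y :
  word_span C l x -> word_span C l y -> word_span C l (a *: x + y).
Proof.
move=> Cx Cy; elim: Cx => [|b w {}x sw _ IH]; first by rewrite scaler0 add0r.
by rewrite scalerDr scalerA -addrA; apply: word_span_lin.
Qed.

Lemma word_span_word l w : (size w <= l)%N -> word_span C l (word C w).
Proof.
by move=> sw; rewrite -[word C w]scale1r -[_ *: _]addr0; apply: word_span_lin => //; left.
Qed.

Lemma word_span_mul l i x : word_span C l x -> word_span C l.+1 (C i *m x).
Proof.
elim=> [|a w {}x sw _ IH]; first by rewrite mulmx0; left.
by rewrite mulmxDr -scalemxAr; apply: (@word_span_lin _ _ _ _ _ (i :: w)).
Qed.

Lemma word_span_le l m x : (l <= m)%N -> word_span C l x -> word_span C m x.
Proof.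
move=> lm; elim=> [|a w {}x sw _ IH]; first by left.
by apply: word_span_lin => //; apply: leq_trans lm.
Qed.

(** The spaces spanned by the words of length at most [l] grow with [l]; once
two successive ones agree they stop growing, and this happens before the
dimension [K * K] of the ambient space is exceeded.  The bound depends on [K]
alone, which is why finitely many traces serve all tuples. *)
Lemma word_span_bounded w : word_span C (K * K) (word C w).
Proof.
suff [l lK stable] : exists2 l, (l <= K * K)%N &
    forall x, word_span C l.+1 x -> word_span C l x.
  apply: (word_span_le lK); elim: w => [|i w IH]; first exact: word_span_word.
  by apply/stable/word_span_mul.
apply: NNPP => unstable.
have rk l : (l <= (K * K).+1)%N -> exists k (B : 'M[F]_(k, K * K)),
    (l <= \rank B)%N /\ forall v, word_span C l (vec_mx v) <-> (v <= B)%MS.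
  elim: l => [_|l IH lK].
    have [||k [B [_ BP]]] := @subspace_row_base _ (fun v => word_span C 0 (vec_mx v)).
    - by rewrite linear0; left.
    - by move=> a u v; rewrite linearP; apply: word_spanP.
    by exists k, B.
  have [k [B [rB BP]]] := IH (ltnW lK).
  have [||k' [B' [_ BP']]] := @subspace_row_base _ (fun v => word_span C l.+1 (vec_mx v)).
  - by rewrite linear0; left.
  - by move=> a u v; rewrite linearP; apply: word_spanP.
  exists k', B'; split=> //; apply: leq_ltn_trans rB _; apply: rank_ltmx; apply/andP; split.
    by apply/row_subP => i; apply/BP'/(word_span_le (leqnSn l))/BP/row_sub.
  apply/negP => B'B; apply: unstable; exists l => // x; rewrite -[x]mxvecK => /BP' xB'.
  by apply/BP; apply: submx_trans B'B.
have [k [B [rB _]]] := rk _ (leqnn _).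
by have := leq_trans rB (rank_leq_col B); rewrite ltnn.
Qed.

End BoundedWords.
End RealMatrices.

(** * The three algebras with involution *)

(** What the proof uses of the three pairs [(D, vartheta)].  [re] is the real part,
for which [re (inv_map x * y)] is a scalar product with orthonormal basis
[basis]; the coordinates of products, conjugates and [ctr] in this basis are
rational.  [ctr] is the projection of [D] onto its centre along the
commutators, i.e. the reduced trace divided by its value at [1]; by [ctr_inj]
it is known from its real part and from [im].  The field [flip] changes the sign
of [im]: it is the conjugation of [F(sqrt -1)], and the identity when [im = 0],
i.e. in the two cases whose centre is [F]. *)
Record star_data (F : rcfType) (D : inv_alg F) := StarData {
  deg : nat;
  basis : 'I_deg.+1 -> D;
  re : D -> F;
  im : D -> F;
  ctr : D -> D;
  flip : D -> D;
  scD : {morph @inv_scalar F D : x y / x + y};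
  sc1 : inv_scalar D 1 = 1;
  scM : {morph @inv_scalar F D : x y / x * y};
  scC : forall r x, inv_scalar D r * x = x * inv_scalar D r;
  cjD : {morph @inv_map F D : x y / x + y};
  cjM : forall x y : D, inv_map (x * y) = inv_map y * inv_map x;
  cjK : involutive (@inv_map F D);
  cj_sc : forall r, inv_map (inv_scalar D r) = inv_scalar D r;
  reD : {morph re : x y / x + y};
  reZ : forall r x, re (inv_scalar D r * x) = r * re x;
  re_sc : forall r, re (inv_scalar D r) = r;
  reC : forall x y, re (x * y) = re (y * x);
  re_cj : forall x, re (inv_map x) = re x;
  basis0 : basis ord0 = 1;
  basisE : forall x,
    x = \sum_k inv_scalar D (re (inv_map (basis k) * x)) * basis k;
  basis_orth : forall i j, re (inv_map (basis i) * basis j) = (i == j)%:R;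
  basis_mul : forall i j k, rational (re (inv_map (basis i) * (basis j * basis k)));
  basis_cj : forall i j, rational (re (inv_map (basis i) * inv_map (basis j)));
  basis_ctr : forall i j, rational (re (inv_map (basis i) * ctr (basis j)));
  ctrD : {morph ctr : x y / x + y};
  ctrZ : forall r x, ctr (inv_scalar D r * x) = inv_scalar D r * ctr x;
  ctrC : forall x y, ctr x * y = y * ctr x;
  ctr_commutators : forall x, exists s : seq (D * D),
    x = ctr x + \sum_(p <- s) (p.1 * p.2 - p.2 * p.1);
  ctr_re : forall x, ctr x + inv_map (ctr x) = inv_scalar D (re x *+ 2);
  ctr_im : forall x y, (ctr x - inv_map (ctr x)) * (ctr y - inv_map (ctr y)) =
    - inv_scalar D ((im x * im y) *+ 4);
  ctr_inj : forall x y, re x = re y -> im x = im y -> ctr x = ctr y;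
  flipD : {morph flip : x y / x + y};
  flipM : {morph flip : x y / x * y};
  flipK : involutive flip;
  flip_sc : forall r, flip (inv_scalar D r) = inv_scalar D r;
  flip_cj : forall x, flip (inv_map x) = inv_map (flip x);
  flip_ctr : forall x, flip (ctr x) = ctr (flip x);
  re_flip : forall x, re (flip x) = re x;
  im_flip : forall x, im (flip x) = - im x;
  exists_inverse : forall x : D, x != 0 -> exists y, y * x = 1
}.

Lemma real_star_data (F : rcfType) : star_data (real_alg F).
Proof.
pose D : inv_alg F := real_alg F.
apply: (@StarData F D 0 (fun=> 1) id (fun=> 0) id id) => //=.
- by move=> r x; rewrite mulrC.
- by move=> x y; rewrite mulrC.
- by move=> x y; rewrite mulrC.
- by move=> x; rewrite big_ord1 mul1r mulr1.
- by move=> i j; rewrite !ord1 mulr1.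
- by move=> *; rewrite !mulr1; exact: rational1.
- by move=> *; rewrite !mulr1; exact: rational1.
- by move=> *; rewrite !mulr1; exact: rational1.
- by move=> x y; rewrite mulrC.
- by move=> x; exists [::]; rewrite big_nil addr0.
- by move=> x y; rewrite !subrr !mul0r mul0rn oppr0.
- by move=> _; rewrite oppr0.
- by move=> x x0; exists x^-1; rewrite mulVf.
Qed.

Ltac rat_arith := do ?[apply: rationalD|apply: rationalM|apply: rationalN|
  exact: rational0|exact: rational1].

Lemma complex_star_data (F : rcfType) : star_data (complex_alg F).
Proof.
pose D : inv_alg F := complex_alg F.
pose b (k : 'I_2) : F[i] := if k == ord0 then 1 else 'i%C.
have bE (k : 'I_2) : k = ord0 \/ k = lift ord0 ord0.
  by case: k => -[|[|//]] ?; [left|right]; apply/val_inj.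
apply: (@StarData F D 1 b (fun z => complex.Re z) (fun z => complex.Im z) id (conjc)) => //=.
- by move=> x y; rewrite rmorphD.
- by move=> x y; rewrite rmorphM.
- by move=> r x; rewrite mulrC.
- by move=> x y; rewrite rmorphD.
- by move=> x y; rewrite rmorphM mulrC.
- exact: conjcK.
- by move=> r; rewrite /real_complex_def /= oppr0.
- by case=> a a' [c c'].
- by move=> r [a a'] /=; rewrite mul0r subr0.
- by move=> x y; rewrite mulrC.
- by case.
- by case=> x y; rewrite !big_ord_recl big_ord0 /b /=; simpc; congr (_ +i* _)%C; ring.
- by move=> i j; case: (bE i) => ->; case: (bE j) => ->; rewrite /b /=; ring.
- move=> i j k; case: (bE i) => ->; case: (bE j) => ->; case: (bE k) => ->; rewrite /b /=;
  by rat_arith.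
- move=> i j; case: (bE i) => ->; case: (bE j) => ->; rewrite /b /=; by rat_arith.
- move=> i j; case: (bE i) => ->; case: (bE j) => ->; rewrite /b /=; by rat_arith.
- by move=> x y; rewrite mulrC.
- by move=> x; exists [::]; rewrite big_nil addr0.
- by case=> x y; apply/eqP; rewrite eq_complex /=; apply/andP; split; apply/eqP; ring.
- by case=> x y [z t]; apply/eqP; rewrite eq_complex /=; apply/andP; split; apply/eqP; ring.
- by case=> x y [z t] /= -> ->.
- by move=> x y; rewrite rmorphD.
- by move=> x y; rewrite rmorphM.
- exact: conjcK.
- by move=> r; rewrite /real_complex_def /= oppr0.
- by case.
- by case.
- by move=> x x0; exists x^-1; rewrite mulVf.
Qed.

Lemma quaternion_star_data (F : rcfType) : star_data (quaternion_alg F).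
Proof.
pose D : inv_alg F := quaternion_alg F.
pose b (k : 'I_4) : quaternion F :=
  Quat (k == 0%N :> nat)%:R (k == 1%N :> nat)%:R (k == 2%N :> nat)%:R (k == 3%N :> nat)%:R.
apply: (@StarData F D 3 b (@q1 F) (fun=> 0) (fun x => quat_scalar (q1 x)) id) => //=.
- by move=> x y; congr Quat => /=; ring.
- by move=> x y; congr Quat => /=; ring.
- by move=> r [a c d e]; congr Quat => /=; ring.
- by move=> x y; congr Quat => /=; ring.
- by move=> x y; congr Quat => /=; ring.
- by case=> a c d e; congr Quat => /=; ring.
- by move=> r; congr Quat => /=; ring.
- by move=> r [a c d e] /=; ring.
- by move=> x y /=; ring.
- by case=> a c d e; rewrite !big_ord_recl big_ord0 /b /=; congr Quat => /=; ring.
- move=> i j; rewrite -val_eqE.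
  by case: i => -[|[|[|[|//]]]] ?; case: j => -[|[|[|[|//]]]] ? /=; ring.
- move=> i j k; case: i => -[|[|[|[|//]]]] ?; 
  case: j => -[|[|[|[|//]]]] ?; 
  case: k => -[|[|[|[|//]]]] ?; rewrite /=; by rat_arith.
- move=> i j; case: i => -[|[|[|[|//]]]] ?; 
  case: j => -[|[|[|[|//]]]] ?; rewrite /=; by rat_arith.
- move=> i j; case: i => -[|[|[|[|//]]]] ?; 
  case: j => -[|[|[|[|//]]]] ?; rewrite /=; by rat_arith.
- by move=> x y; congr Quat => /=; ring.
- by move=> r [a c d e]; congr Quat => /=; ring.
- by move=> x [a c d e]; congr Quat => /=; ring.
- case=> a c d e; pose h (r : F) := quat_scalar (r / 2).
  exists [:: (h c * quat_j F, quat_k F); (h d * quat_k F, quat_i F); (h e * quat_i F, quat_j F)].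
  by rewrite !big_cons big_nil /=; congr Quat => /=; field.
- by case=> a c d e; congr Quat => /=; ring.
- by move=> x y; rewrite mul0r mul0rn; congr Quat => /=; ring.
- by move=> x y -> .
- by move=> x; rewrite oppr0.
- case=> a c d e x0; pose n := a ^+ 2 + c ^+ 2 + d ^+ 2 + e ^+ 2.
  have n0 : n != 0.
    apply: contraNneq x0 => n0.
    have [a0 [c0 [d0 e0]]] : a = 0 /\ c = 0 /\ d = 0 /\ e = 0.
      by move: n0; rewrite /n; do !split; nra.
    by rewrite a0 c0 d0 e0.
  exists (quat_scalar n^-1 * quat_conj (Quat a c d e)).
  congr Quat => /=; [|ring|ring|ring].
  by rewrite -(mulVf n0) /n; ring.
Qed.


(** * Matrices over [D] as real matrices *)

Section AdditiveMaps.
Variables (U V : zmodType) (f : U -> V).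
Hypothesis fD : {morph f : x y / x + y}.

Lemma morph_add0 : f 0 = 0.
Proof. by apply: (addrI (f 0)); rewrite -fD !addr0. Qed.

Lemma morph_addN x : f (- x) = - f x.
Proof. by apply: (addrI (f x)); rewrite -fD !subrr morph_add0. Qed.

Lemma morph_addB x y : f (x - y) = f x - f y.
Proof. by rewrite fD morph_addN. Qed.

Lemma morph_add_sum I (s : seq I) (P : pred I) (g : I -> U) :
  f (\sum_(i <- s | P i) g i) = \sum_(i <- s | P i) f (g i).
Proof. exact: (big_morph f fD morph_add0). Qed.

Lemma morph_addMn x k : f (x *+ k) = f x *+ k.
Proof. by elim: k => [|k IH]; rewrite ?mulr0n ?morph_add0 // !mulrS fD IH. Qed.
End AdditiveMaps.

Section MatrixAlgebra.
Variables (F : rcfType) (D : inv_alg F) (S : star_data D).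

Notation sc := (@inv_scalar F D).
Notation cj := (@inv_map F D).
Notation d := (deg S).+1.
Notation b := (@basis F D S).

(** Coordinates in the orthonormal basis. *)
Definition co (k : 'I_d) (x : D) : F := re S (cj (b k) * x).

Lemma coD k : {morph co k : x y / x + y}.
Proof. by move=> x y; rewrite /co mulrDr (reD S). Qed.

Lemma coZ k r x : co k (sc r * x) = r * co k x.
Proof. by rewrite /co mulrA -(scC S) -mulrA (reZ S). Qed.

Lemma co_basis k j : co k (b j) = (k == j)%:R.
Proof. exact: basis_orth. Qed.

Lemma coE x : x = \sum_k sc (co k x) * b k.
Proof. exact: (basisE S). Qed.

Lemma co_inj x y : (forall k, co k x = co k y) -> x = y.
Proof. by move=> xy; rewrite (coE x) (coE y); apply: eq_bigr => k _; rewrite xy. Qed.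

Definition of_co (f : 'I_d -> F) : D := \sum_k sc (f k) * b k.

Lemma of_coK f k : co k (of_co f) = f k.
Proof.
rewrite (morph_add_sum (coD k)) (bigD1 k) //= coZ co_basis eqxx mulr1 big1 ?addr0 //.
by move=> j /negPf kj; rewrite coZ co_basis eq_sym kj mulr0.
Qed.

Lemma co_mul k x y : co k (x * y) = \sum_j co k (x * b j) * co j y.
Proof.
rewrite {1}(coE y) mulr_sumr (morph_add_sum (coD k)); apply: eq_bigr => j _.
by rewrite mulrA -(scC S) -mulrA coZ mulrC.
Qed.

Lemma co_cj k j x : co k (cj x * b j) = co j (x * b k).
Proof. by rewrite /co -(re_cj S) !(cjM S) !(cjK S) mulrA. Qed.

Lemma co_mul_cj k j y : co k (b j * cj y) = co j (b k * y).
Proof.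
by rewrite /co -(re_cj S) !(cjM S) !(cjK S) -mulrA (reC S) mulrA (reC S) mulrA.
Qed.

Lemma sc0 : sc 0 = 0. Proof. exact: (morph_add0 (scD S)). Qed.

Section Embedding.
Variable n : nat.

(** The left action of [M_n(D)] on the columns [D^n], in real coordinates. *)
Definition emb (a : 'M[D]_n) : 'M[F]_(n * d) :=
  \matrix_(p, q) let: (i, k) := mxtens_unindex p in let: (j, l) := mxtens_unindex q in
    co k (a i j * b l).

(** The right multiplication by [y] of the entries of a column. *)
Definition right_mul (y : D) : 'M[F]_(n * d) :=
  \matrix_(p, q) let: (i, k) := mxtens_unindex p in let: (j, l) := mxtens_unindex q in
    (i == j)%:R * co k (b l * y).

Lemma embE a i k j l : emb a (mxtens_index (i, k)) (mxtens_index (j, l)) = co k (a i j * b l).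
Proof. by rewrite mxE !mxtens_indexK. Qed.

Lemma right_mulE y i k j l :
  right_mul y (mxtens_index (i, k)) (mxtens_index (j, l)) = (i == j)%:R * co k (b l * y).
Proof. by rewrite mxE !mxtens_indexK. Qed.

Lemma sum_mxtens (f : 'I_(n * d) -> F) :
  \sum_p f p = \sum_i \sum_k f (mxtens_index (i, k)).
Proof.
rewrite pair_bigA /= (reindex (@mxtens_index n d)) /=; first by apply: eq_bigr => -[].
by exists (@mxtens_unindex n d) => p _; rewrite ?mxtens_indexK ?mxtens_unindexK.
Qed.

Lemma tens_matrixP (X Y : 'M[F]_(n * d)) :
  (forall i k j l, X (mxtens_index (i, k)) (mxtens_index (j, l)) =
                   Y (mxtens_index (i, k)) (mxtens_index (j, l))) -> X = Y.
Proof.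
by move=> XY; apply/matrixP => p q; case: (mxtens_indexP p) => i k; case: (mxtens_indexP q).
Qed.

Lemma embD : {morph emb : x y / x + y}.
Proof. by move=> x y; apply: tens_matrixP => *; rewrite [RHS]mxE !embE mxE mulrDl coD. Qed.

Lemma emb_mul x y : emb (x *m y) = emb x *m emb y.
Proof.
apply: tens_matrixP => i k j l; rewrite embE [RHS]mxE sum_mxtens [X in co k (X * _)]mxE mulr_suml.
rewrite (morph_add_sum (coD k)); apply: eq_bigr => m _.
by rewrite -mulrA co_mul; apply: eq_bigr => c _; rewrite !embE.
Qed.

Lemma emb1 : emb 1%:M = 1%:M.
Proof.
apply: tens_matrixP => i k j l; rewrite embE !mxE (can_eq (@mxtens_indexK _ _)) xpair_eqE.
by case: (i == j); rewrite ?mul1r ?co_basis // mul0r (morph_add0 (coD k)).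
Qed.

Lemma emb_inj : injective emb.
Proof.
move=> x y xy; apply/matrixP => i j; apply: co_inj => k.
have /matrixP/(_ (mxtens_index (i, k)) (mxtens_index (j, ord0))) := xy.
by rewrite !embE (basis0 S) !mulr1.
Qed.

Lemma emb_tr a : emb (inv_trmx a) = (emb a)^T.
Proof. by apply: tens_matrixP => i k j l; rewrite [RHS]mxE !embE !mxE co_cj. Qed.

Lemma right_mul_tr y : (right_mul y)^T = right_mul (cj y).
Proof.
by apply: tens_matrixP => i k j l; rewrite [LHS]mxE !right_mulE co_mul_cj eq_sym.
Qed.

Lemma mul_right_mul (X : 'M[F]_(n * d)) y i k j l :
  (X *m right_mul y) (mxtens_index (i, k)) (mxtens_index (j, l)) =
  \sum_c X (mxtens_index (i, k)) (mxtens_index (j, c)) * co c (b l * y).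
Proof.
rewrite mxE sum_mxtens (bigD1 j) //= [X in _ + X]big1 => [|m /negPf mj].
  by rewrite addr0; apply: eq_bigr => c _; rewrite right_mulE eqxx mul1r.
by apply: big1 => c _; rewrite right_mulE mj mul0r mulr0.
Qed.

Lemma right_mul_mul (X : 'M[F]_(n * d)) y i k j l :
  (right_mul y *m X) (mxtens_index (i, k)) (mxtens_index (j, l)) =
  \sum_c co k (b c * y) * X (mxtens_index (i, c)) (mxtens_index (j, l)).
Proof.
rewrite mxE sum_mxtens (bigD1 i) //= [X in _ + X]big1 => [|m /negPf mi].
  by rewrite addr0; apply: eq_bigr => c _; rewrite right_mulE eqxx mul1r.
by apply: big1 => c _; rewrite right_mulE eq_sym mi !mul0r.
Qed.

Lemma emb_right_mul a y : emb a *m right_mul y = right_mul y *m emb a.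
Proof.
apply: tens_matrixP => i k j l; rewrite mul_right_mul right_mul_mul.
transitivity (co k (a i j * (b l * y))).
  by rewrite co_mul; apply: eq_bigr => c _; rewrite embE.
rewrite mulrA {1}(coE (a i j * b l)) mulr_suml (morph_add_sum (coD k)).
by apply: eq_bigr => c _; rewrite embE -mulrA coZ mulrC.
Qed.

(** As [1] is the basis vector of index [ord0], a matrix commuting with the right
multiplications is determined by its columns of index [(j, ord0)], and these give
the entries of [a]. *)
Lemma commutant_right_mul (X : 'M[F]_(n * d)) :
  (forall y, X *m right_mul y = right_mul y *m X) -> exists a, X = emb a.
Proof.
move=> XR; exists (\matrix_(i, j) of_co (fun c => X (mxtens_index (i, c)) (mxtens_index (j, ord0)))).
apply: tens_matrixP => i k j l; rewrite embE mxE.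
have /matrixP/(_ (mxtens_index (i, k)) (mxtens_index (j, ord0))) := XR (b l).
rewrite mul_right_mul right_mul_mul (bigD1 l) //= (basis0 S) mul1r co_basis eqxx mulr1.
rewrite big1 ?addr0 => [->|c /negPf cl]; last by rewrite co_basis cl mulr0.
rewrite mulr_suml (morph_add_sum (coD k)); apply: eq_bigr => c _.
by rewrite -mulrA coZ mulrC.
Qed.

End Embedding.

(** ** Trace functionals and the reduced trace *)

Section Trace.
Variable n' : nat.
Notation n := n'.+1.
Implicit Types (a : 'M[D]_n) (x : D).

Definition unit_mx x (i j : 'I_n) : 'M[D]_n := \matrix_(k, l) (x *+ ((k == i) && (l == j))).

Lemma unit_mx_mul x y i j k : unit_mx x i j *m unit_mx y j k = unit_mx (x * y) i k.
Proof.
apply/matrixP => p q; rewrite !mxE (bigD1 j) //= big1 ?addr0 => [|l /negPf lj].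
  by rewrite !mxE eqxx andbT /=; case: (p == i); rewrite ?mul0r //=; case: (q == k); rewrite ?mulr0.
by rewrite !mxE lj andbF mul0r.
Qed.

Lemma unit_mx_mul0 x y i j k l : j != k -> unit_mx x i j *m unit_mx y k l = 0.
Proof.
move=> jk; apply/matrixP => p q; rewrite !mxE big1 // => m _; rewrite !mxE.
case: (eqVneq m j) => [->|_]; last by rewrite andbF mul0r.
by rewrite (negPf jk) mulr0.
Qed.

Lemma unit_mxD i j : {morph (fun x => unit_mx x i j) : x y / x + y}.
Proof. by move=> x y; apply/matrixP => p q; rewrite !mxE mulrnDl. Qed.

Lemma sum_unit_mx a : a = \sum_i \sum_j unit_mx (a i j) i j.
Proof.
apply/matrixP => p q; rewrite summxE (bigD1 p) //= [X in _ + X]big1 ?addr0 => [|i /negPf ip].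
  rewrite summxE (bigD1 q) //= big1 ?addr0 => [|j /negPf jq]; first by rewrite mxE !eqxx.
  by rewrite mxE eq_sym jq andbF.
by rewrite summxE big1 // => j _; rewrite mxE eq_sym ip.
Qed.

(** The scalar matrix with the same reduced trace as [a]. *)
Definition ctr_mx a : 'M[D]_n := (sc n%:R^-1 * ctr S (\tr a))%:M.

(** Modulo commutators every matrix is [x E_00] with [x] its trace, and [x]
can be replaced by the central [ctr x]; so a trace functional cannot tell a
matrix from the scalar matrix with the same reduced trace. *)
Lemma tracial_ctr_mx (V : zmodType) (f : 'M[D]_n -> V) :
    {morph f : x y / x + y} -> (forall a a', f (a *m a') = f (a' *m a)) ->
  forall a, f a = f (ctr_mx a).
Proof.
move=> fD fC; pose t x := f (unit_mx x ord0 ord0).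
have tD : {morph t : x y / x + y} by move=> x y; rewrite /t unit_mxD fD.
have ft a : f a = t (\tr a).
  rewrite {1}(sum_unit_mx a) (morph_add_sum fD) (morph_add_sum tD).
  apply: eq_bigr => i _; rewrite (morph_add_sum fD) (bigD1 i) //= big1 ?addr0.
    by rewrite -{1}[a i i]mulr1 -(unit_mx_mul _ _ i ord0 i) fC unit_mx_mul mul1r.
  move=> j ji; rewrite -[a i j]mulr1 -(unit_mx_mul _ _ i j j) fC unit_mx_mul0 //.
  exact: morph_add0.
have tC x : t x = t (ctr S x).
  have [s xs] := ctr_commutators S x; rewrite {1}xs tD (morph_add_sum tD) big1 ?addr0 //.
  move=> [y z] _; rewrite (morph_addB tD) /t -(unit_mx_mul y z ord0 ord0 ord0) fC.
  by rewrite unit_mx_mul subrr.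
move=> a; rewrite ft tC [RHS]ft mxtrace_scalar -mulrnAl -(morph_addMn (scD S)).
by rewrite -[_ *+ n]mulr_natl mulfV ?pnatr_eq0 // (sc1 S) mul1r.
Qed.

Lemma central_scalar x : (forall y, x * y = y * x) -> @central 'M[D]_n x%:M.
Proof.
move=> xC a; apply/matrixP => i j; rewrite /GRing.comm !mxE (bigD1 i) //= [RHS](bigD1 j) //=.
rewrite !mxE !eqxx !mulr1n !big1 ?addr0 // => k /negPf ki; rewrite !mxE.
  by rewrite ki mulr0.
by rewrite eq_sym ki mul0r.
Qed.

Lemma ctr_mx_central a : central (ctr_mx a).
Proof. by apply: central_scalar => y; rewrite -mulrA (ctrC S) mulrA (scC S) mulrA. Qed.

Lemma mul_unit_mx x y a i j k l :
  unit_mx x k i *m a *m unit_mx y j l = unit_mx (x * a i j * y) k l.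
Proof.
apply/matrixP => p q; rewrite !mxE (bigD1 j) //= [X in _ + X]big1 ?addr0 => [|m /negPf mj].
  rewrite !mxE (bigD1 i) //= [X in _ + X]big1 ?addr0 => [|m /negPf mi].
    rewrite !mxE !eqxx andbT /=.
    by case: (p == k); rewrite ?mulr0n ?mul0r //=; case: (q == l); rewrite ?mulr0.
  by rewrite !mxE mi andbF mulr0n mul0r.
by rewrite !mxE mj /= mulr0n mulr0.
Qed.

Section ReducedTrace.
Variable trd : 'M[D]_n -> 'M[D]_n.
Hypothesis htrd : is_reduced_trace trd.

(** A reduced trace kills commutators and is linear over the centre, so it is
determined by its value at [1], which is the degree [r] of the splitting
representation [g].  These properties are read off from [g], which is injective
because [M_n(D)] is a simple ring. *)
Theorem reduced_traceE : (forall a a', trd (a *m a') = trd (a' *m a)) /\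
  exists2 q : rat, 0 < q & forall a, trd a = (sc (ratr q) * ctr S (\tr a))%:M.
Proof.
have [E [r [g [[gc [I [B [Bspan [h hK _]]]]] trdP]]]] := htrd.
have gM (x y : 'M[D]_n) : g (x *m y) = g x *m g y by exact: rmorphM.
have gD (x y : 'M[D]_n) : g (x + y) = g x + g y by exact: rmorphD.
have g1 : g 1%:M = 1%:M by exact: rmorph1.
have r_gt0 : (0 < r)%N.
  rewrite lt0n; apply/eqP => r0.
  (* in degree [0] the basis would be empty, and [1] an empty sum *)
  have I0 (i : I) : False.
    have E01 : [ffun=> 0] = [ffun=> 1] :> {ffun I -> E}.
      rewrite -[LHS]hK -[RHS]hK; congr h; apply/matrixP => p.
      by have := ltn_ord p; rewrite [X in (_ < X)%N]r0.
    by have /ffunP/(_ i)/eqP := E01; rewrite !ffunE eq_sym oner_eq0.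
  have [c [[_ one0] _]] := Bspan 1%:M.
  have /matrixP/(_ ord0 ord0)/eqP := one0.
  by rewrite big1 => [|i]; [rewrite !mxE oner_eq0|case: (I0 i)].
have one_neq0 : 1%:M != 0 :> 'M[E]_r.
  by apply/eqP => /matrixP/(_ (Ordinal r_gt0) (Ordinal r_gt0))/eqP; rewrite !mxE eqxx oner_eq0.
(* a nonzero entry [x i j] lets one write [1] as a sum of multiples of [x] *)
have g_eq0 (x : 'M[D]_n) : g x = 0 -> x = 0.
  move=> gx; apply/matrixP => i j; rewrite mxE; apply/eqP; apply: contraNT one_neq0 => xij.
  have [y yx] := exists_inverse S xij.
  rewrite -g1 (_ : 1%:M = \sum_k unit_mx y k i *m x *m unit_mx 1 j k).
    by rewrite (morph_add_sum gD) big1 // => k _; rewrite !gM gx mulmx0 mul0mx.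
  transitivity (\sum_k unit_mx 1 k k).
    rewrite [LHS]sum_unit_mx; apply: eq_bigr => k _.
    rewrite (bigD1 k) //= [X in _ + X]big1 => [|l lk]; first by rewrite addr0 mxE eqxx.
    by rewrite mxE eq_sym (negPf lk) (morph_add0 (unit_mxD _ _)).
  by apply: eq_bigr => k _; rewrite mul_unit_mx yx mulr1.
have g_inj (x y : 'M[D]_n) : g x = g y -> x = y.
  move=> gxy; apply/eqP; rewrite -subr_eq0; apply/eqP/g_eq0.
  by rewrite (morph_addB gD) gxy subrr.
have gtrd (x : 'M[D]_n) : g (trd x) = (\tr (g x))%:M by have [] := trdP x.
have trdD : {morph trd : x y / x + y}.
  by move=> x y; apply: g_inj; rewrite gD !gtrd gD mxtraceD raddfD.
have trdC (x y : 'M[D]_n) : trd (x *m y) = trd (y *m x).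
  by apply: g_inj; rewrite !gtrd !gM mxtrace_mulC.
have trdZ (c x : 'M[D]_n) : central c -> trd (c *m x) = c *m trd x.
  move=> /gc /is_scalar_mxP[e ge]; apply: g_inj.
  by rewrite gM !gtrd gM ge mul_scalar_mx mxtraceZ scalar_mxM.
have trd1 : trd 1%:M = (r%:R)%:M.
  apply: g_inj; rewrite gtrd g1 mxtrace1 -!(scalemx1 _ r%:R) !scaler_nat.
  by rewrite (morph_addMn gD) g1.
split=> //; exists (r%:R / n%:R) => [|a]; first by rewrite divr_gt0 ?ltr0n.
rewrite (tracial_ctr_mx trdD trdC) -[ctr_mx a]mulmx1 trdZ; last exact: ctr_mx_central.
rewrite trd1 -scalar_mxM; congr _%:M.
have -> : r%:R = sc r%:R :> D by rewrite (morph_addMn (scD S)) (sc1 S).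
by rewrite -(scC S) mulrA -(scM S) fmorph_div !rmorph_nat.
Qed.

End ReducedTrace.
End Trace.
End MatrixAlgebra.

(** * Unitary equivalence in [M_n(D)] *)

Section UnitaryEquivalence.
Variables (F : rcfType) (D : inv_alg F) (S : star_data D) (n' : nat).

Notation sc := (@inv_scalar F D).
Notation cj := (@inv_map F D).
Notation n := n'.+1.
Notation N := (n * (deg S).+1)%N.
Implicit Types a u : 'M[D]_n.

Lemma inv_trmxK : involutive (@inv_trmx F D n).
Proof. by move=> a; apply/matrixP => i j; rewrite !mxE (cjK S). Qed.

Lemma inv_trmxM a u : inv_trmx (a *m u) = inv_trmx u *m inv_trmx a.
Proof.
apply/matrixP => i j; rewrite !mxE (morph_add_sum (cjD S)).
by apply: eq_bigr => k _; rewrite !mxE (cjM S).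
Qed.

Lemma cj1 : cj 1 = 1.
Proof. by rewrite -(sc1 S) (cj_sc S). Qed.

Lemma inv_trmx_scalar x : @inv_trmx F D n x%:M = (cj x)%:M.
Proof.
apply/matrixP => i j; rewrite !mxE (morph_addMn (cjD S)).
by rewrite eq_sym.
Qed.

Lemma emb_scale c a : emb S (sc c *: a) = c *: emb S a.
Proof.
by apply: tens_matrixP => i k j l; rewrite [RHS]mxE !embE mxE -mulrA coZ.
Qed.

Lemma ctr_tr_scale c a : ctr S (\tr (sc c *: a)) = sc c * ctr S (\tr a).
Proof. by rewrite mxtraceZ (ctrZ S). Qed.

Section Families.
Variables (I : Type) (A B : I -> 'M[D]_n) (s : I -> I).
Hypotheses (As : forall i, A (s i) = inv_trmx (A i))
  (Bs : forall i, B (s i) = inv_trmx (B i)).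

Lemma emb_word (C : I -> 'M[D]_n) w : emb S (word C w) = word (fun i => emb S (C i)) w.
Proof. by elim: w => [|i w IH] /=; rewrite ?emb1 // emb_mul IH. Qed.

(** A family in [M_n(D)] is enlarged by the right multiplications; an orthogonal
matrix commuting with these comes from a unitary matrix of [M_n(D)], and the
trace of a word containing right multiplications is still a trace functional of
the part of the word in [M_n(D)]. *)
Lemma unitary_equivalence :
    (forall w, ctr S (\tr (word A w)) = ctr S (\tr (word B w))) ->
  exists u : 'M[D]_n, [/\ inv_trmx u *m u = 1%:M, u *m inv_trmx u = 1%:M &
    forall i, u *m A i = B i *m u].
Proof.
move=> AB.
pose ext (C : I -> 'M[D]_n) (i : I + D) : 'M[F]_N :=
  match i with inl i => emb S (C i) | inr y => right_mul S n y end.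
pose s' (i : I + D) : I + D := match i with inl i => inl (s i) | inr y => inr (cj y) end.
(* right multiplications can be collected at the end of a word *)
have extw w : exists w0 J, [/\ forall a, emb S a *m J = J *m emb S a,
    word (ext A) w = emb S (word A w0) *m J & word (ext B) w = emb S (word B w0) *m J].
  elim: w => [|[i|y] w [w0 [J [JC Aw Bw]]]] /=.
  - by exists [::], 1%:M; split=> [a||] /=; rewrite ?emb1 !(mul1mx, mulmx1).
  - by exists (i :: w0), J; split=> //; rewrite ?Aw ?Bw mulmxA /= emb_mul.
  - exists w0, (right_mul S n y *m J); split=> [a||].
    + by rewrite mulmxA emb_right_mul -mulmxA JC mulmxA.
    + by rewrite Aw !mulmxA emb_right_mul.
    + by rewrite Bw !mulmxA emb_right_mul.
have [i|i|w|U [UtU UUt UAB]] := @specht F N (I + D)%type (ext A) (ext B) s'.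
- by case: i => [i|y] /=; rewrite ?As ?emb_tr ?right_mul_tr.
- by case: i => [i|y] /=; rewrite ?Bs ?emb_tr ?right_mul_tr.
- have [w0 [J [JC -> ->]]] := extw w.
  pose f a := \tr (emb S a *m J).
  have fD : {morph f : a u / a + u} by move=> a u; rewrite /f embD mulmxDl mxtraceD.
  have fC a u : f (a *m u) = f (u *m a).
    by rewrite /f !emb_mul -mulmxA JC mulmxA mxtrace_mulC mulmxA.
  by rewrite -!/(f _) (tracial_ctr_mx S fD fC) [RHS](tracial_ctr_mx S fD fC) /ctr_mx AB.
have [y|u Uu] := @commutant_right_mul _ _ S n U; first exact: (UAB (inr y)).
exists u; split=> [||i]; apply: (@emb_inj _ _ S n); rewrite ?emb_mul ?emb_tr ?emb1 -Uu //.
exact: (UAB (inl i)).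
Qed.

(** Words in the block sums of the [A_i] and [B_i], matrices of size [N + N], are
linear combinations of those of length at most [(N + N) ^ 2]; this propagates the
equality of traces to words of any length. *)
Lemma bounded_unitary_equivalence :
    (forall w, (size w <= (N + N) * (N + N))%N ->
      ctr S (\tr (word A w)) = ctr S (\tr (word B w))) ->
  exists u : 'M[D]_n, [/\ inv_trmx u *m u = 1%:M, u *m inv_trmx u = 1%:M &
    forall i, u *m A i = B i *m u].
Proof.
move=> AB; apply: unitary_equivalence => w.
pose C i : 'M[F]_(N + N) := block_mx (emb S (A i)) 0 0 (emb S (B i)).
have wE v : word C v = block_mx (emb S (word A v)) 0 0 (emb S (word B v)).
  by rewrite word_block !emb_word.
suff: exists a a', word C w = block_mx (emb S a) 0 0 (emb S a') /\
    ctr S (\tr a) = ctr S (\tr a').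
  by rewrite wE => -[a [a' [/eq_block_mx[/emb_inj-> _ _ /emb_inj->]]]].
move: (word C w) (word_span_bounded C w) => X; elim=> [|c v x sv _ [a [a' [-> aa']]]].
  exists 0, 0; split=> //.
  by rewrite (morph_add0 (@embD _ _ S n)) -[LHS]block_mx0.
exists (sc c *: word A v + a), (sc c *: word B v + a'); split.
  by rewrite wE scale_block_mx add_block_mx !scaler0 !addr0 !embD !emb_scale.
by rewrite !mxtraceD !(ctrD S) !ctr_tr_scale AB // aa'.
Qed.

End Families.
End UnitaryEquivalence.

(** * Invariants and definable sets in [M_n(D)] *)

Section MatrixStructure.
Variables (F : rcfType) (D : inv_alg F) (S : star_data D) (n' : nat).
Notation sc := (@inv_scalar F D).
Notation cj := (@inv_map F D).
Notation n := n'.+1.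
Notation d := (deg S).+1.
Variables (trd : 'M[D]_n -> 'M[D]_n) (rho : F).
Hypothesis trdC : forall a a', trd (a *m a') = trd (a' *m a).
Hypotheses (rho_rational : rational rho) (rho_neq0 : rho != 0).
Hypothesis trdE : forall a, trd a = (sc rho * ctr S (\tr a))%:M.

Notation M := (matrix_structure trd).

(** ** Automorphisms *)

Lemma star_automorphism (phi psi : 'M[D]_n -> 'M[D]_n) :
    cancel phi psi -> cancel psi phi -> {morph phi : x y / x + y} ->
    (forall x y, phi (x *m y) = phi x *m phi y) ->
    (forall x, phi (inv_trmx x) = inv_trmx (phi x)) ->
    (forall x, phi (trd x) = trd (phi x)) ->
    (forall c, phi (sc c)%:M = (sc c)%:M) ->
  @automorphism M phi psi.
Proof.
move=> phiK psiK phiD phiM phiS phiT phiC.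
have phi1 : phi 1%:M = 1%:M by rewrite -(sc1 S) phiC.
have phiF x : @s_F M (phi x) <-> @s_F M x.
  split=> -[/= xC xS]; split.
  - by move=> y; apply: (can_inj phiK); rewrite -!mulmxE !phiM; exact: xC.
  - by apply: (can_inj phiK); rewrite phiS.
  - by move=> y; rewrite -(psiK y); have := congr1 phi (xC (psi y)); rewrite -!mulmxE !phiM.
  - by rewrite /= -phiS xS.
have phiP x : @s_P M (phi x) <-> @s_P M x.
  split=> -[c c0 xc]; exists c => //; last by rewrite xc phiC.
  by apply: (can_inj phiK); rewrite phiC.
split; first by split.
split; first by split=> //; exact: morph_add0.
by split=> //; split=> // x; exact: morph_addN.
Qed.

Lemma holds_unitary (u : 'M[D]_n) (e : nat -> M) f :
    inv_trmx u *m u = 1%:M -> u *m inv_trmx u = 1%:M ->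
  holds ((fun i => u *m e i *m inv_trmx u) : nat -> M) f <-> holds e f.
Proof.
move=> utu uut.
apply: (@holds_automorphism M (fun a => u *m a *m inv_trmx u)
  (fun a => inv_trmx u *m a *m u)); apply: star_automorphism => [a|a|a a'|a a'|a|a|c].
- by rewrite !mulmxA utu mul1mx -mulmxA utu mulmx1.
- by rewrite !mulmxA uut mul1mx -mulmxA uut mulmx1.
- by rewrite mulmxDr mulmxDl.
- by rewrite !mulmxA -(mulmxA (u *m a) (inv_trmx u) u) utu mulmx1.
- by rewrite !(inv_trmxM S) (inv_trmxK S) mulmxA.
- rewrite [in RHS]trdC !mulmxA utu mul1mx trdE.
  set z := _%:M; have zC : central z.
    by apply: central_scalar => y; rewrite -mulrA (ctrC S) !mulrA (scC S).
  have -> : u *m z = z *m u by exact/esym/zC.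
  by rewrite -mulmxA uut mulmx1.
- have -> : u *m (sc c)%:M = (sc c)%:M *m u.
    by apply/esym; apply: (@central_scalar _ D n' (sc c)) => y; rewrite (scC S).
  by rewrite -mulmxA uut mulmx1.
Qed.

Lemma flip1 : flip S 1 = 1.
Proof. by rewrite -(sc1 S) (flip_sc S). Qed.

Lemma flip_mxM (a a' : 'M[D]_n) :
  map_mx (flip S) (a *m a') = map_mx (flip S) a *m map_mx (flip S) a'.
Proof.
apply/matrixP => i j; rewrite !mxE (morph_add_sum (flipD S)).
by apply: eq_bigr => k _; rewrite !mxE (flipM S).
Qed.

Lemma flip_mx_scalar x : map_mx (flip S) (x%:M : 'M[D]_n) = (flip S x)%:M.
Proof. by apply/matrixP => i j; rewrite !mxE (morph_addMn (flipD S)). Qed.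

Lemma flip_mx_tr (a : 'M[D]_n) : \tr (map_mx (flip S) a) = flip S (\tr a).
Proof. by rewrite /mxtrace (morph_add_sum (flipD S)); apply: eq_bigr => i _; rewrite mxE. Qed.

Lemma flip_mx_inv_trmx (a : 'M[D]_n) :
  map_mx (flip S) (inv_trmx a) = inv_trmx (map_mx (flip S) a).
Proof. by apply/matrixP => i j; rewrite !mxE (flip_cj S). Qed.

Lemma holds_flip (e : nat -> M) f :
  holds ((fun i => map_mx (flip S) (e i)) : nat -> M) f <-> holds e f.
Proof.
have flip_mxK : involutive (map_mx (flip S) : 'M[D]_n -> 'M[D]_n).
  by move=> a; apply/matrixP => i j; rewrite !mxE (flipK S).
apply: (@holds_automorphism M (map_mx (flip S)) (map_mx (flip S))).
apply: star_automorphism => // [a a'|a a'|a|a|c].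
- by apply/matrixP => i j; rewrite !mxE (flipD S).
- exact: flip_mxM.
- exact: flip_mx_inv_trmx.
- by rewrite !trdE flip_mx_scalar (flipM S) (flip_sc S) flip_mx_tr (flip_ctr S).
- by rewrite flip_mx_scalar (flip_sc S).
Qed.

(** ** Invariants *)

Notation letter := (nat * bool)%type.

Definition letter_term (l : letter) := if l.2 then Sigma (Var l.1) else Var l.1.
Definition letter_mx (e : nat -> 'M[D]_n) (l : letter) :=
  if l.2 then inv_trmx (e l.1) else e l.1.
Definition word_term (w : seq letter) := foldr (fun l t => Mul (letter_term l) t) One w.
(** The traces of words are central but need not lie in [F]; the terms
[sum_term] and [prod_term] extract from them elements of [F]: up to nonzero
factors these are real parts and products of two imaginary parts. *)
Definition trace_term w := Trd (word_term w).
Definition sum_term w := Add (trace_term w) (Sigma (trace_term w)).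
Definition diff_term w := Add (trace_term w) (Opp (Sigma (trace_term w))).
Definition prod_term w w' := Opp (Mul (diff_term w) (diff_term w')).

(** The element of [F] denoted by a term whose value is a real scalar matrix. *)
Definition value (e : nat -> M) t : F := re S ((eval e t : 'M[D]_n) ord0 ord0).

Lemma value_scalar e t c : eval e t = (sc c)%:M :> M -> value e t = c.
Proof. by move=> h; rewrite /value h mxE eqxx mulr1n (re_sc S). Qed.

Lemma eval_word e w : eval e (word_term w) = word (letter_mx e) w :> M.
Proof. by elim: w => //= -[i []] w ->. Qed.

Lemma cj_trace x : cj (sc rho * ctr S x) = sc rho * cj (ctr S x).
Proof. by rewrite (cjM S) (cj_sc S) (scC S). Qed.

Lemma scalar_mxD (x y : D) : x%:M + y%:M = (x + y)%:M :> 'M[D]_n.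
Proof. by apply/matrixP => i j; rewrite !mxE mulrnDl. Qed.

Lemma scalar_mxN (x : D) : - x%:M = (- x)%:M :> 'M[D]_n.
Proof. by apply/matrixP => i j; rewrite !mxE mulNrn. Qed.

Lemma eval_sum (e : nat -> M) w : eval e (sum_term w) =
  (sc (rho * (re S (\tr (word (letter_mx e) w)) *+ 2)))%:M :> M.
Proof.
rewrite /= trdE eval_word (inv_trmx_scalar S) cj_trace scalar_mxD.
by rewrite -mulrDr (ctr_re S) (scM S).
Qed.

Lemma eval_diff (e : nat -> M) w : let x := ctr S (\tr (word (letter_mx e) w)) in
  eval e (diff_term w) = (sc rho * (x - cj x))%:M :> M.
Proof.
rewrite /= trdE eval_word (inv_trmx_scalar S) cj_trace scalar_mxN scalar_mxD.
by rewrite mulrBr.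
Qed.

Lemma eval_prod (e : nat -> M) w w' : eval e (prod_term w w') =
  (sc (rho * rho * ((im S (\tr (word (letter_mx e) w)) *
     im S (\tr (word (letter_mx e) w'))) *+ 4)))%:M :> M.
Proof.
have -> : eval e (prod_term w w') =
   - ((eval e (diff_term w) : 'M[D]_n) *m (eval e (diff_term w') : 'M[D]_n)) :> M by [].
rewrite !eval_diff -scalar_mxM scalar_mxN; congr _%:M.
rewrite mulrA -(mulrA (sc _)) -(scC S) mulrA -mulrA (ctr_im S) mulrN opprK.
by rewrite -!(scM S).
Qed.

Fixpoint words (s : seq letter) k : seq (seq letter) :=
  if k is k'.+1 then [::] :: [seq l :: w | l <- s, w <- words s k'] else [:: [::]].

Lemma mem_words s k w : (size w <= k)%N -> {subset w <= s} -> w \in words s k.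
Proof.
elim: k w => [|k IH] [|l w] //= sw ws; rewrite inE; apply/orP; right.
apply: allpairs_f; first by apply: ws; rewrite mem_head.
by apply: IH => // l' l'w; apply: ws; rewrite inE l'w orbT.
Qed.

Lemma words_sub s k w : w \in words s k -> {subset w <= s}.
Proof.
elim: k w => [|k IH] w /=; first by rewrite inE => /eqP->.
rewrite inE => /predU1P[->//|/allpairsP[[l w'] /= [ls /IH w's ->]]] l'.
by rewrite inE => /predU1P[->//|/w's].
Qed.

Definition letters (V : seq nat) : seq letter := [seq (v, b) | v <- V, b <- [:: false; true]].

Lemma mem_letters V l : (l \in letters V) = (l.1 \in V).
Proof.
apply/allpairsP/idP => [[[v c] /= [vV _ ->]]//|lV].
by exists l; split=> //; [case: l.2|case: l lV].
Qed.

Let bound := ((n * d + n * d) * (n * d + n * d))%N.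

Definition invariants V : seq term :=
  let ws := words (letters V) bound in
  map sum_term ws ++ map (fun p => prod_term p.1 p.2) [seq (w, w') | w <- ws, w' <- ws].

Lemma same_traces_holds e e' f V : {subset free_vars f <= V} ->
    (forall w, w \in words (letters V) bound ->
      ctr S (\tr (word (letter_mx e) w)) = ctr S (\tr (word (letter_mx e') w))) ->
  holds (e : nat -> M) f <-> holds (e' : nat -> M) f.
Proof.
move=> fV ww; pose I := {l : letter | l.1 \in V}.
pose s (l : I) : I := exist (fun l => l.1 \in V) ((sval l).1, ~~ (sval l).2) (valP l).
have lS (e1 : nat -> 'M[D]_n) l : letter_mx e1 (sval (s l)) = inv_trmx (letter_mx e1 (sval l)).
  by case: l => -[v []] lV; rewrite /letter_mx /= ?(inv_trmxK S).
have wE (e1 : nat -> 'M[D]_n) (w : seq I) :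
    word (letter_mx e1 \o sval) w = word (letter_mx e1) (map sval w).
  by elim: w => //= l w ->.
have [|||u [utu uut uA]] := @bounded_unitary_equivalence F D S n' I
    (letter_mx e \o sval) (letter_mx e' \o sval) s.
- exact: lS.
- exact: lS.
- move=> w sw; rewrite !wE; apply: ww; apply: mem_words; first by rewrite size_map.
  by move=> _ /mapP[l _ ->]; rewrite mem_letters (valP l).
rewrite -(holds_unitary e f utu uut); apply: holds_ext => v /fV vV.
have := uA (exist _ (v, false) vV); rewrite /letter_mx /= => ->.
by rewrite -mulmxA uut mulmx1.
Qed.

(** The products of imaginary parts determine the family of imaginary parts up to
a common sign, and the sign is absorbed by the automorphism [flip]. *)
Lemma same_invariants_holds e e' f V : {subset free_vars f <= V} ->
    map (value e) (invariants V) = map (value e') (invariants V) ->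
  holds (e : nat -> M) f <-> holds (e' : nat -> M) f.
Proof.
move=> fV; rewrite /invariants; set ws := words _ _.
have: forall w w', w \in ws -> w' \in ws -> (w, w') \in [seq (w, w') | w <- ws, w' <- ws].
  by move=> w w' wws w'ws; apply: allpairs_f.
move: [seq _ | _ <- ws, _ <- ws] => ps wps; rewrite !map_cat -!map_comp.
move/eqP; rewrite eqseq_cat ?size_map // => /andP[/eqP sumE /eqP prodE].
have {}sumE : {in ws, value e \o sum_term =1 value e' \o sum_term} by apply/eq_in_map.
have {}prodE : {in ps, value e \o (fun p => prod_term p.1 p.2) =1
                       value e' \o (fun p => prod_term p.1 p.2)} by apply/eq_in_map.
pose tr (e1 : nat -> 'M[D]_n) w := \tr (word (letter_mx e1) w).
have reE w : w \in ws -> re S (tr e w) = re S (tr e' w).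
  move=> /sumE /=; rewrite !(value_scalar (eval_sum _ _)) => /(mulfI rho_neq0) /eqP.
  by rewrite -subr_eq0 -mulrnBl mulrn_eq0 subr_eq0 => /eqP.
have imE w w' : w \in ws -> w' \in ws ->
    im S (tr e w) * im S (tr e w') = im S (tr e' w) * im S (tr e' w').
  move=> wws w'ws; have /prodE /= := wps _ _ wws w'ws.
  rewrite !(value_scalar (eval_prod _ _ _)) => /(mulfI (mulf_neq0 rho_neq0 rho_neq0)) /eqP.
  by rewrite -subr_eq0 -mulrnBl mulrn_eq0 subr_eq0 => /eqP.
have [h|h] : (forall w, w \in ws -> im S (tr e w) = im S (tr e' w)) \/
             (forall w, w \in ws -> im S (tr e w) = - im S (tr e' w)).
  have [/hasP[w0 w0ws im0]|/hasPn im0] := boolP (has (fun w => im S (tr e w) != 0) ws).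
    have /eqP := imE _ _ w0ws w0ws; rewrite -!expr2 eqf_sqr => /orP[]/eqP E; [left|right] => w wws.
      by apply: (mulfI im0); rewrite imE // E.
    by apply: (mulfI im0); rewrite imE // E mulrNN.
  left=> w wws; have /negPn/eqP h := im0 w wws; rewrite h; apply/esym/eqP.
  by rewrite -[_ == 0]orbb -mulf_eq0 -imE // h mul0r.
- by apply: (same_traces_holds fV) => w wws; apply: (ctr_inj (reE w wws)); exact: h.
rewrite -(holds_flip e'); apply: (same_traces_holds fV) => w wws.
have -> : word (letter_mx (fun i => map_mx (flip S) (e' i))) w =
          map_mx (flip S) (word (letter_mx e') w).
  elim: w {wws} => [|[v c] w IH] /=; first by rewrite flip_mx_scalar flip1.
  by rewrite flip_mxM IH; congr (_ *m _); case: c; rewrite /letter_mx //= flip_mx_inv_trmx.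
rewrite flip_mx_tr; apply: (@ctr_inj _ _ S); first by rewrite (re_flip S) reE.
by rewrite (im_flip S) h.
Qed.

(** ** Definability over [F] *)

Lemma mem_block k m v v' r : (r < k)%N ->
  (m + v * k <= m + v' * k + r < m + v * k + k)%N = (v == v').
Proof.
move=> rk; apply/idP/eqP => [|->]; last by rewrite leq_addr ltn_add2l.
rewrite -!addnA leq_add2l ltn_add2l => /andP[h1 h2].
by apply/eqP; rewrite eqn_leq; apply/andP; split; rewrite leqNgt; apply/negP => h; nia.
Qed.

Lemma block_bound s m k i : (s + (m + k) <= i)%N -> (s <= i)%N /\ ~~ (m <= i < m + k)%N.
Proof. by move=> ?; split; lia. Qed.


Notation co := (@co F D S).
Notation bas := (@basis F D S).
Notation cell := ('I_n * 'I_n * 'I_d)%type.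
Notation block := #|{: cell}|.

Definition entry (a : 'M[D]_n) (x : cell) : F := co x.2 (a x.1.1 x.1.2).

Definition of_entry (g : cell -> F) : 'M[D]_n :=
  \matrix_(i, j) of_co (fun k => g (i, j, k)).

Lemma of_entryK g x : entry (of_entry g) x = g x.
Proof. by case: x => [[i j] k]; rewrite /entry mxE of_coK. Qed.

Lemma entry_inj a a' : (forall x, entry a x = entry a' x) -> a = a'.
Proof. by move=> aa'; apply/matrixP => i j; apply: (@co_inj _ _ S) => k; exact: (aa' (i, j, k)). Qed.

Definition rational_mx (A : seq F -> 'M[D]_n) :=
  forall x, rational_fun (fun E => entry (A E) x).

Definition rational_elt (A : seq F -> D) :=
  forall k, rational_fun (fun E => co k (A E)).

Lemma rational_eltM A B : rational_elt A -> rational_elt B ->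
  rational_elt (fun E => A E * B E).
Proof.
move=> rA rB k.
have E x y : co k (x * y) = \sum_i \sum_j
    co i x * co j y * re S (cj (bas k) * (bas i * bas j)).
  rewrite {1}(coE S x) mulr_suml (morph_add_sum (@coD _ _ S k)); apply: eq_bigr => i _.
  rewrite {1}(coE S y) mulr_sumr (morph_add_sum (@coD _ _ S k)); apply: eq_bigr => j _.
  by rewrite mulrA -(mulrA (sc _)) -(scC S (co j y)) -!mulrA !coZ mulrA.
apply: (rational_fun_ext (fun e => esym (E (A e) (B e)))).
apply: rational_fun_sum => i; apply: rational_fun_sum => j.
apply: rational_funM; last exact/rational_fun_const/basis_mul.
by apply: rational_funM; [exact: rA|exact: rB].
Qed.

Lemma rational_elt_sum (I : Type) (s : seq I) (A : I -> seq F -> D) :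
  (forall i, rational_elt (A i)) -> rational_elt (fun E => \sum_(i <- s) A i E).
Proof.
move=> rA k; apply: (rational_fun_ext (fun e => esym (morph_add_sum (@coD _ _ S k) _ _ _))).
by apply: rational_fun_sum => i; exact: rA.
Qed.

Lemma rational_elt_linear (h : D -> D) A : {morph h : x y / x + y} ->
    (forall r x, h (sc r * x) = sc r * h x) ->
    (forall k j, rational (re S (cj (bas k) * h (bas j)))) ->
  rational_elt A -> rational_elt (fun E => h (A E)).
Proof.
move=> hD hZ hr rA k.
have E x : co k (h x) = \sum_j co j x * re S (cj (bas k) * h (bas j)).
  rewrite {1}(coE S x) (morph_add_sum hD) (morph_add_sum (@coD _ _ S k)).
  by apply: eq_bigr => j _; rewrite hZ coZ.
apply: (rational_fun_ext (fun e => esym (E (A e)))).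
by apply: rational_fun_sum => j; apply: rational_funM => //; exact: rational_fun_const.
Qed.

Lemma rational_elt_cj A : rational_elt A -> rational_elt (fun E => cj (A E)).
Proof.
apply: rational_elt_linear; first exact: (cjD S).
- by move=> r x; rewrite (cjM S) (cj_sc S) (scC S).
- exact: basis_cj.
Qed.

Lemma rational_elt_ctr A : rational_elt A -> rational_elt (fun E => ctr S (A E)).
Proof. by apply: rational_elt_linear; [exact: ctrD|exact: ctrZ|exact: basis_ctr]. Qed.

Lemma rational_elt_sc g : rational_fun g -> rational_elt (fun E => sc (g E)).
Proof.
move=> rg k; apply: (@rational_fun_ext _ (fun E => g E * (k == ord0)%:R)).
  by move=> E; rewrite -[sc _]mulr1 coZ -(basis0 S) co_basis.
by apply: rational_funM => //; apply/rational_fun_const/rational_nat.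
Qed.

Lemma rational_elt_const0 : rational_elt (fun=> 0).
Proof.
move=> k; apply: rational_fun_ext (rational_fun_const (rational0 F)) => E.
by rewrite (morph_add0 (@coD _ _ S k)).
Qed.

Lemma rational_eltN A : rational_elt A -> rational_elt (fun E => - A E).
Proof.
move=> rA k; apply: rational_fun_ext (rational_funN (rA k)) => E.
by rewrite (morph_addN (@coD _ _ S k)).
Qed.

Lemma rational_eltD A B : rational_elt A -> rational_elt B ->
  rational_elt (fun E => A E + B E).
Proof.
move=> rA rB k; apply: rational_fun_ext (rational_funD (rA k) (rB k)) => E.
by rewrite coD.
Qed.

Lemma rational_elt_mulb A (c : bool) : rational_elt A -> rational_elt (fun E => A E *+ c).
Proof. by case: c => // _; exact: rational_elt_const0. Qed.

Lemma rational_mxP (A : seq F -> 'M[D]_n) : (forall i j, rational_elt (fun E => A E i j)) <-> rational_mx A.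
Proof. by split=> [rA [[i j] k]|rA i j k]; [exact: rA|exact: (rA (i, j, k))]. Qed.

Lemma rational_mx_ext A B : A =1 B -> rational_mx A -> rational_mx B.
Proof. by move=> AB rA x; apply: rational_fun_ext (rA x) => E; rewrite AB. Qed.

Lemma rational_mxM A B : rational_mx A -> rational_mx B ->
  rational_mx (fun E => A E *m B E).
Proof.
move=> /rational_mxP rA /rational_mxP rB; apply/rational_mxP => i j k.
apply: (@rational_fun_ext _ (fun E => co k (\sum_l A E i l * B E l j))).
  by move=> E; rewrite mxE.
by move: k; apply: rational_elt_sum => l; apply: rational_eltM.
Qed.

Lemma rational_mx_inv_trmx A : rational_mx A -> rational_mx (fun E => inv_trmx (A E)).
Proof.
move=> /rational_mxP rA; apply/rational_mxP => i j k.
apply: (@rational_fun_ext _ (fun E => co k (cj (A E j i)))); first by move=> E; rewrite !mxE.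
exact: rational_elt_cj.
Qed.

Lemma rational_mx_scalar A : rational_elt A -> rational_mx (fun E => (A E)%:M).
Proof.
move=> rA; apply/rational_mxP => i j k.
apply: (@rational_fun_ext _ (fun E => co k (A E *+ (i == j)))); first by move=> E; rewrite !mxE.
exact: rational_elt_mulb.
Qed.

Lemma rational_mx_trd A : rational_mx A -> rational_mx (fun E => trd (A E)).
Proof.
move=> rA; apply: (@rational_mx_ext (fun E => (sc rho * ctr S (\tr (A E)))%:M)).
  by move=> E; rewrite trdE.
apply: rational_mx_scalar; apply: rational_eltM.
  by apply: rational_elt_sc; exact: rational_fun_const.
by apply: rational_elt_ctr; apply: rational_elt_sum => i; move/rational_mxP: rA; exact.
Qed.

Definition cell_mx (x : cell) : 'M[D]_n := unit_mx (bas x.2) x.1.1 x.1.2.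

Lemma rational_cell_mx x : rational_mx (fun=> cell_mx x).
Proof.
move=> y; apply: (@rational_fun_ext _ (fun=> (x == y)%:R)).
  case: x y => [[i j] k] [[i' j'] k'] E; rewrite /entry mxE (morph_addMn (@coD _ _ S k')) co_basis.
  rewrite -[RHS]mulr_natr -natrM mulnb !xpair_eqE /= andbC (eq_sym k') (eq_sym i') (eq_sym j').
  by rewrite andbC.
exact/rational_fun_const/rational_nat.
Qed.

(** It is enough to commute with the matrices of an [F]-basis: this describes the
centre by finitely many equations. *)
Lemma central_cell_mx (a : 'M[D]_n) :
  (forall x, a *m cell_mx x = cell_mx x *m a) -> central a.
Proof.
have scale_comm r (y : 'M[D]_n) : a *m y = y *m a -> a *m (sc r *: y) = (sc r *: y) *m a.
  move=> ay; rewrite -scalemxAl -ay; apply/matrixP => i j; rewrite !mxE mulr_sumr.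
  by apply: eq_bigr => k _; rewrite !mxE !mulrA (scC S).
move=> ac y; change (a *m y = y *m a).
rewrite (sum_unit_mx y) mulmx_sumr mulmx_suml; apply: eq_bigr => i _.
rewrite mulmx_sumr mulmx_suml; apply: eq_bigr => j _.
have -> : unit_mx (y i j) i j = \sum_k sc (co k (y i j)) *: cell_mx (i, j, k).
  rewrite {1}(coE S (y i j)) (morph_add_sum (@unit_mxD _ _ _ i j)).
  by apply: eq_bigr => k _; apply/matrixP => p r; rewrite !mxE mulrnAr.
by rewrite mulmx_sumr mulmx_suml; apply: eq_bigr => k _; exact: scale_comm.
Qed.

Lemma rational_set_eq_mx A B : rational_mx A -> rational_mx B ->
  rational_set (fun E => A E = B E).
Proof.
move=> rA rB; apply: (@rational_set_ext _ (fun E => forall x, entry (A E) x = entry (B E) x)).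
  by move=> E; split=> [/entry_inj|->].
by apply: rational_set_all => x; apply: rational_set_eq.
Qed.

(** The offset [m] leaves the first [m] entries of the sequence free, to hold the
values of the invariants. *)
Definition decode m (E : seq F) : nat -> M :=
  fun v => of_entry (fun x => E`_(m + v * block + enum_rank x)).

Lemma rational_mx_eval m t : rational_mx (fun E => eval (decode m E) t).
Proof.
elim: t => [i|||t IHt u IHu|t IHt|t IHt u IHu|t IHt|t IHt] /=.
- move=> x; apply: (@rational_fun_ext _ (fun E => E`_(m + i * block + enum_rank x))) => [E|].
    exact/esym/of_entryK.
  exact: rational_fun_var.
- apply/rational_mxP => i j k; apply: (@rational_fun_ext _ (fun=> co k 0)) => [E|].
    by rewrite mxE.
  exact: rational_elt_const0.
- apply: rational_mx_scalar => k.
  apply: (@rational_fun_ext _ (fun=> co k (sc 1))) => [E|]; first by rewrite (sc1 S).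
  by apply: (@rational_elt_sc (fun=> 1)); exact/rational_fun_const/rational1.
- apply/rational_mxP => i j k.
  apply: (@rational_fun_ext _ (fun E => co k ((eval (decode m E) t : 'M[D]_n) i j +
    (eval (decode m E) u : 'M[D]_n) i j))) => [E|]; first by rewrite mxE.
  by apply: rational_eltD; move: i j; apply/rational_mxP.
- apply/rational_mxP => i j k.
  apply: (@rational_fun_ext _ (fun E => co k (- (eval (decode m E) t : 'M[D]_n) i j))) => [E|].
    by rewrite mxE.
  by apply: rational_eltN; move: i j; apply/rational_mxP.
- exact: rational_mxM.
- exact: rational_mx_inv_trmx.
- exact: rational_mx_trd.
Qed.

Lemma finite_sequence (g : nat -> F) B : (forall i, (B <= i)%N -> g i = 0) ->
  exists E : seq F, forall i, E`_i = g i.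
Proof.
move=> gB; exists (mkseq g B) => i; case: (ltnP i B) => iB; first by rewrite nth_mkseq.
by rewrite nth_default ?size_mkseq // gB.
Qed.

Lemma block_gt0 : (0 < block)%N.
Proof. by apply/card_gt0P; exists (ord0, ord0, ord0). Qed.

Lemma in_block m v v' r : (r < block)%N ->
  (m + v * block <= m + v' * block + r < m + v * block + block)%N = (v == v').
Proof. exact: mem_block. Qed.

Lemma decode_other m E E' v : (forall i, ~~ (m + v * block <= i < m + v * block + block)%N ->
  E'`_i = E`_i) -> forall v', v' != v -> decode m E' v' = decode m E v'.
Proof.
move=> EE' v' v'v; apply: entry_inj => x; rewrite !of_entryK; apply: EE'.
by rewrite in_block // eq_sym.
Qed.

Lemma decode_update m E v (a : M) : exists2 E' : seq F,
  forall i, ~~ (m + v * block <= i < m + v * block + block)%N -> E'`_i = E`_i &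
  decode m E' =1 update (decode m E) v a.
Proof.
pose g i := if (m + v * block <= i < m + v * block + block)%N then
  (if insub (i - (m + v * block))%N is Some r then entry a (enum_val (r : 'I_block)) else 0)
  else E`_i.
have [i|E' E'E] := @finite_sequence g (size E + (m + v * block + block)).
  by move=> /block_bound[sE iv]; rewrite /g ifN // nth_default.
have EE' i : ~~ (m + v * block <= i < m + v * block + block)%N -> E'`_i = E`_i.
  by move=> iv; rewrite E'E /g ifN.
exists E' => // v'; rewrite /update; case: eqP => [->|/eqP v'v]; last exact: decode_other v'v.
apply: entry_inj => x; rewrite of_entryK E'E /g in_block // eqxx addKn.
by rewrite valK enum_rankK.
Qed.

Lemma rational_set_exists_matrix m v X : rational_set X -> forall Y : (nat -> M) -> Prop,
    (forall E, X E <-> Y (decode m E)) ->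
    (forall e e', e =1 e' -> Y e <-> Y e') ->
  rational_set (fun E => exists a : M, Y (update (decode m E) v a)).
Proof.
move=> rX Y XY Yext; apply: rational_set_ext (rational_set_exists_range (m + v * block) block rX).
move=> E; split=> [[E' XE' EE']|[a Ya]].
  exists (decode m E' v); rewrite (Yext _ (decode m E')); first exact/XY.
  by move=> v'; rewrite /update; case: eqP => [->//|/eqP v'v]; rewrite (decode_other EE' v'v).
have [E' EE' E'a] := decode_update m E v a; exists E' => //.
by apply/XY; rewrite (Yext _ _ E'a).
Qed.

Lemma rational_set_holds m f : rational_set (fun E => holds (decode m E) f).
Proof.
have hext g e e' : e =1 e' -> holds (e : nat -> M) g <-> holds e' g.
  by move=> ee'; apply: holds_ext => v _.
elim: f => /= [t u|t|t||f IH|f IHf g IHg|f IHf g IHg|f IHf g IHg|v f IH|v f IH].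
- by apply: rational_set_eq_mx; exact: rational_mx_eval.
- apply: (@rational_set_ext _ (fun E =>
    (forall x, (eval (decode m E) t : 'M[D]_n) *m cell_mx x = cell_mx x *m (eval (decode m E) t : 'M[D]_n)) /\
    inv_trmx (eval (decode m E) t : 'M[D]_n) = eval (decode m E) t)).
    by move=> E; split=> -[aC aS]; split=> //; [exact: central_cell_mx|move=> x; exact: aC].
  apply: rational_set_and.
    apply: rational_set_all => x; apply: rational_set_eq_mx; apply: rational_mxM;
      by [exact: rational_mx_eval|exact: rational_cell_mx].
  by apply: rational_set_eq_mx; [apply: rational_mx_inv_trmx|]; exact: rational_mx_eval.
- pose c E := entry (eval (decode m E) t) (ord0, ord0, ord0).
  have rc : rational_fun c by exact: rational_mx_eval.
  apply: (@rational_set_ext _ (fun E => eval (decode m E) t = (sc (c E))%:M :> M /\ 0 <= c E)).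
    move=> E; split=> [[tE c0]|[x x0 tE]]; first by exists (c E).
    suff -> : c E = x by [].
    by rewrite /c tE /entry mxE eqxx mulr1n -[sc x]mulr1 coZ -(basis0 S) co_basis eqxx mulr1.
  apply: rational_set_and; last exact: rational_set_ge0.
  by apply: rational_set_eq_mx; [exact: rational_mx_eval|exact/rational_mx_scalar/rational_elt_sc].
- by apply: rational_set_ext (rational_set_not (@rational_setT F)) => E; tauto.
- exact: rational_set_not.
- exact: rational_set_and.
- apply: rational_set_ext (rational_set_not (rational_set_and (rational_set_not IHf)
    (rational_set_not IHg))) => E.
  by case: (classic (holds (decode m E) f)); tauto.
- apply: rational_set_ext (rational_set_not (rational_set_and IHf (rational_set_not IHg))) => E.
  by case: (classic (holds (decode m E) g)); tauto.
- by apply: (@rational_set_exists_matrix m v _ IH (fun e => holds e f)) => // e e'; exact: hext.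
- apply: rational_set_ext (rational_set_not (@rational_set_exists_matrix m v _
    (rational_set_not IH) (fun e => ~ holds e f) _ _)) => [E|//|e e' ee'].
    split=> [h a|h [a]]; last by apply.
    by apply: NNPP => na; apply: h; exists a.
  by rewrite (hext f e e').
Qed.

Lemma invariants_vars V : each (fun t => {subset term_vars t <= V}) (invariants V).
Proof.
have wV w : {subset w <= letters V} -> {subset term_vars (word_term w) <= V}.
  elim: w => //= -[v c] w IH lw i; rewrite mem_cat => /orP[iv|].
    have -> : i = v by case: c iv {lw} => /=; rewrite mem_seq1 => /eqP.
    by have := lw (v, c) (mem_head _ _); rewrite mem_letters.
  by apply: IH => l ls; apply: lw; rewrite inE ls orbT.
rewrite /invariants; set ws := words _ _.
have: forall w, w \in ws -> {subset w <= letters V} by exact: words_sub.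
move: ws => ws wsV.
apply: each_cat; first by apply: each_map_in => w /wsV/wV wV' i /=; rewrite mem_cat orbb => /wV'.
apply: each_map_in => p /allpairsP[[w w'] /= [/wsV/wV wV' /wsV/wV w'V ->]] i /=.
by rewrite !mem_cat !orbb => /orP[/wV'|/w'V].
Qed.

Lemma invariants_scalar V :
  each (fun t => forall e : nat -> M, eval e t = (sc (value e t))%:M :> M) (invariants V).
Proof.
rewrite /invariants; apply: each_cat; apply: each_map_in => p _ e.
  by rewrite (value_scalar (eval_sum e p)) eval_sum.
by rewrite (value_scalar (eval_prod e p.1 p.2)) eval_prod.
Qed.

Lemma sc_mx_inj (x y : F) : (sc x)%:M = (sc y)%:M :> 'M[D]_n -> x = y.
Proof.
by move=> /matrixP/(_ ord0 ord0)/(congr1 (re S)); rewrite !mxE !eqxx !mulr1n !(re_sc S).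
Qed.

(** ** From rational formulas to formulas of [L] *)

Section Realize.
Variables (V : seq nat) (T : seq term).
Hypothesis TV : each (fun t => {subset term_vars t <= V}) T.
Hypothesis Tsc : each (fun t => forall e : nat -> M, eval e t = (sc (value e t))%:M :> M) T.

Let represents (t : term) (g : (nat -> M) -> F) :=
  {subset term_vars t <= V} /\ forall e : nat -> M, eval e t = (sc (g e))%:M :> M.

Let represents0 : represents Zero (fun=> 0).
Proof. by split=> // e /=; rewrite (sc0 S) raddf0. Qed.

Let represents1 : represents One (fun=> 1).
Proof. by split=> // e /=; rewrite (sc1 S). Qed.

Let representsD t u g h : represents t g -> represents u h ->
  represents (Add t u) (fun e => g e + h e).
Proof.
move=> [tV te] [uV ue]; split=> [i|e] /=; first by rewrite mem_cat => /orP[/tV|/uV].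
by rewrite te ue scalar_mxD (scD S).
Qed.

Let representsN t g : represents t g -> represents (Opp t) (fun e => - g e).
Proof. by move=> [tV te]; split=> // e /=; rewrite te scalar_mxN (morph_addN (scD S)). Qed.

Let representsM t u g h : represents t g -> represents u h ->
  represents (Mul t u) (fun e => g e * h e).
Proof.
move=> [tV te] [uV ue]; split=> [i|e] /=; first by rewrite mem_cat => /orP[/tV|/uV].
by rewrite te ue -scalar_mxM (scM S).
Qed.

Let represents_ext t g h : g =1 h -> represents t g -> represents t h.
Proof. by move=> gh [tV te]; split=> // e; rewrite te gh. Qed.

Let represents_nat k : exists t, represents t (fun=> k%:R).
Proof.
elim: k => [|k [t rt]]; first by exists Zero.
exists (Add One t); apply: represents_ext (representsD represents1 rt) => e.
by rewrite mulrS.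
Qed.

Let represents_int (z : int) : exists t, represents t (fun=> z%:~R).
Proof.
case: z => k; first exact: represents_nat.
have [t rt] := represents_nat k.+1; exists (Opp t).
exact: represents_ext (representsN rt).
Qed.

(** Terms of [L] have integer coefficients only; [k] is a common denominator. *)
Lemma realize_term (t : qe_rcf.term F) : rat_term t -> exists k u, (0 < k)%N /\
  represents u (fun e => k%:R * qe_rcf.eval (map (value e) T) t).
Proof.
elim: t => [i|c|k|t IHt u IHu|t IHt|t IHt k|t IHt u IHu|t IHt k] /=.
- move=> _; exists 1%N, (nth Zero T i); split=> //; split.
    by apply: (each_nth (P := fun t => {subset term_vars t <= V})).
  have z0 e : eval e Zero = (sc (value e Zero))%:M :> M.
    by have [_ /(_ e) ze] := represents0; rewrite (value_scalar ze).
  move=> e; rewrite mul1r; case: (ltnP i (size T)) => iT.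
    rewrite (nth_map Zero) //.
    exact: (each_nth (P := fun t => forall e : nat -> M, eval e t = (sc (value e t))%:M :> M) i z0 Tsc).
  rewrite !nth_default ?size_map //; have [_] := represents0; exact.
- move=> [r ->]; have [u ru] := represents_int (numq r).
  exists `|denq r|%N, u; split; first by rewrite absz_gt0 denq_neq0.
  apply: represents_ext ru => e; rewrite /ratr mulrCA.
  have -> : `|denq r|%:R = (denq r)%:~R :> F by rewrite natr_absz normr_denq.
  by rewrite mulfV ?mulr1 // intr_eq0 denq_neq0.
- move=> _; have [u ru] := represents_nat k; exists 1%N, u; split=> //.
  apply: represents_ext ru => e. by rewrite mul1r.
- move=> [/IHt[k [t' [k0 rt]]] /IHu[l [u' [l0 ru]]]].
  have [kt rk] := represents_nat k; have [lt rl] := represents_nat l.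
  exists (k * l)%N, (Add (Mul lt t') (Mul kt u')); split; first by rewrite muln_gt0 k0.
  apply: represents_ext (representsD (representsM rl rt) (representsM rk ru)) => e.
  by rewrite natrM mulrDr !mulrA (mulrC l%:R).
- move=> /IHt[k [t' [k0 rt]]]; exists k, (Opp t'); split=> //.
  by apply: represents_ext (representsN rt) => e; rewrite mulrN.
- move=> /IHt[l [t' [l0 rt]]]; have [kt rk] := represents_nat k.
  exists l, (Mul kt t'); split=> //; apply: represents_ext (representsM rk rt) => e.
  by rewrite mulrCA [X in _ * X]mulr_natl.
- move=> [/IHt[k [t' [k0 rt]]] /IHu[l [u' [l0 ru]]]].
  exists (k * l)%N, (Mul t' u'); split; first by rewrite muln_gt0 k0.
  by apply: represents_ext (representsM rt ru) => e; rewrite natrM mulrACA.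
- move=> /IHt[l [t' [l0 rt]]]; elim: k => [|k [k' [u [k0 ru]]]].
    by exists 1%N, One; split=> //; apply: represents_ext represents1 => e; rewrite mul1r.
  exists (l * k')%N, (Mul t' u); split; first by rewrite muln_gt0 l0.
  by apply: represents_ext (representsM rt ru) => e; rewrite natrM mulrACA exprS.
Qed.

Lemma realize_formula (f : qe_rcf.formula F) : rat_form f -> exists g,
  [/\ quantifier_free g, {subset free_vars g <= V} &
      forall e : nat -> M, holds e g <-> qe_rcf.qf_eval (map (value e) T) f].
Proof.
have ge0 t u : rat_term t -> rat_term u -> exists g,
    [/\ quantifier_free g, {subset free_vars g <= V} & forall e : nat -> M, holds e g <->
      qe_rcf.eval (map (value e) T) t <= qe_rcf.eval (map (value e) T) u].
  move=> rt ru; have [|k [s [k0 [sV se]]]] := @realize_term (qe_rcf.Add u (qe_rcf.Opp t)).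
    by [].
  exists (InP s); split=> // e /=; rewrite se /= -subr_ge0.
  rewrite -[X in _ <-> is_true X](pmulr_rge0 _ (_ : 0 < k%:R)) ?ltr0n //.
  by split=> [[c c0 /sc_mx_inj->]|c0] //; exists (k%:R * (qe_rcf.eval (map (value e) T) u - qe_rcf.eval (map (value e) T) t)).
elim: f => [c|t u|t u|t u|f IHf g IHg|f IHf g IHg|f IHf g IHg|f IHf] /=.
- case: c => _; [exists (Not Bot)|exists Bot]; split=> // e /=; first by split=> // _ [].
- move=> [rt ru]; have [|k [s [k0 [sV se]]]] := @realize_term (qe_rcf.Add t (qe_rcf.Opp u)).
    by [].
  exists (Equal s Zero); split=> [//|i|e] /=; first by rewrite cats0 => /sV.
  rewrite se /= -subr_eq0; have [_ e0] := represents0.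
  have -> : (0 : 'M[D]_n) = (sc 0)%:M by exact: (e0 e).
  split=> [/sc_mx_inj/eqP|/eqP->]; last by rewrite mulr0.
  by rewrite mulf_eq0 pnatr_eq0 (gtn_eqF k0).
- move=> [rt ru]; have [g [qg gV ge]] := ge0 u t ru rt.
  by exists (Not g); split=> // e /=; rewrite ge ltNge; split=> /negP.
- by move=> [rt ru]; exact: ge0.
- move=> [/IHf[f' [qf fV fe]] /IHg[g' [qg gV ge]]]; exists (Defs.And f' g'); split=> /=.
  + by rewrite qf.
  + by move=> i; rewrite mem_cat => /orP[/fV|/gV].
  + by move=> e; rewrite fe ge; split=> /andP.
- move=> [/IHf[f' [qf fV fe]] /IHg[g' [qg gV ge]]]; exists (Defs.Or f' g'); split=> /=.
  + by rewrite qf.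
  + by move=> i; rewrite mem_cat => /orP[/fV|/gV].
  + by move=> e; rewrite fe ge; split=> /orP.
- move=> [/IHf[f' [qf fV fe]] /IHg[g' [qg gV ge]]]; exists (Defs.Implies f' g'); split=> /=.
  + by rewrite qf.
  + by move=> i; rewrite mem_cat => /orP[/fV|/gV].
  + by move=> e; rewrite fe ge; split=> /implyP.
- move=> /IHf[f' [qf fV fe]]; exists (Not f'); split=> //= e.
  by rewrite fe; split=> /negP.
Qed.

End Realize.

(** The set of vectors of invariants of the tuples that satisfy [f] is a
projection, hence quantifier-free definable, and [f] holds at a tuple as soon as
its vector of invariants belongs to this set, by [same_invariants_holds]. *)
Theorem elimination_in_structure f : exists g,
  [/\ quantifier_free g, {subset free_vars g <= free_vars f} &
      forall e : nat -> M, holds e f <-> holds e g].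
Proof.
pose V := free_vars f; pose T := invariants V; pose m := size T.
pose dec := decode m.
pose B := (\max_(v <- V) v).+1.
have VB v : v \in V -> (v < B)%N by move=> vV; rewrite /B ltnS; apply: (leq_bigmax_seq (F := id)).
have block0 : (0 < block)%N by exact: block_gt0.
have [//|h rh hE] := @rational_set_exists_range F m (B * block) (fun E =>
    (forall j : 'I_m, value (dec E) (nth Zero T j) = E`_j) /\ holds (dec E) f).
  apply: rational_set_and; last exact: rational_set_holds.
  apply: rational_set_all => j.
  apply: (@rational_set_eq F (fun E => value (dec E) (nth Zero T j)) (fun E => E`_j)); last exact: rational_fun_var.
  have E0 (E : seq F) : entry (eval (dec E) (nth Zero T j) : 'M[D]_n) (ord0, ord0, ord0) = value (dec E) (nth Zero T j).
    by rewrite /entry /co /value (basis0 S) (cj1 S) mul1r.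
  apply: (rational_fun_ext E0).
  exact: rational_mx_eval.
have [g [qg gV ge]] := realize_formula (invariants_vars V) (invariants_scalar V) rh.
exists g; split=> // e; rewrite ge -hE; split=> [fe|[E [Ej Ef] Ee]].
  pose y i := if (i < m)%N then (map (value e) T)`_i else
    if (i < m + B * block)%N then
      (if insub ((i - m) %% block)%N is Some r
       then entry (e ((i - m) %/ block)%N) (enum_val (r : 'I_block)) else 0)
    else 0.
  (* [y] lists the invariants of [e], then the coordinates of [e v], [v < B] *)
  have [i iB|E EE] := @finite_sequence y (m + B * block).
    by rewrite /y !ifN // -leqNgt //; apply: leq_trans iB; rewrite leq_addr.
  have decE v : (v < B)%N -> dec E v = e v.
    move=> vB; apply: entry_inj => x; rewrite of_entryK EE /y.
    rewrite ifN; last by rewrite -leqNgt -addnA leq_addr.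
    rewrite ifT; last first.
      rewrite -addnA ltn_add2l; apply: (@leq_trans (v.+1 * block)%N).
        by rewrite mulSn addnC ltn_add2r ltn_ord.
      by rewrite leq_mul2r vB orbT.
    rewrite -addnA addKn modnMDl modn_small ?ltn_ord // valK enum_rankK.
    by rewrite divnMDl // divn_small ?ltn_ord // addn0.
  exists E; last first.
    move=> i im; rewrite EE /y; case: ifP => // i1; rewrite ifN; last by lia.
    by rewrite nth_default // size_map leqNgt i1.
  split; last first.
    by apply: (holds_ext (M := M) (e := e) _).1 => // v /VB vB; rewrite decE.
  move=> j; rewrite EE /y ltn_ord (nth_map Zero) // /value.
  rewrite (@eval_ext M _ (dec E) e) // => v vt; apply/decE/VB; move: v vt.
  exact: (each_nth (P := fun t => {subset term_vars t <= V}) j _ (invariants_vars V)).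
apply/(same_invariants_holds (V := V) _ _).2: Ef => //.
apply: (@eq_from_nth _ 0); rewrite !size_map // => i iT.
rewrite [RHS](nth_map Zero) // (Ej (Ordinal iT)) /= -Ee //.
by rewrite negb_and -ltnNge iT.
Qed.

End MatrixStructure.

(** * The theorem *)

Theorem proposition3p3 (F : rcfType) (n : nat) (D : inv_alg F)
    (hD : D = real_alg F \/ D = complex_alg F \/ D = quaternion_alg F)
    (trd : 'M[D]_n -> 'M[D]_n) (htrd : is_reduced_trace trd) :
  quantifier_elimination (theory_of (matrix_structure trd)).
Proof.
apply: quantifier_elimination_theory_of => f.
case: n trd htrd => [trd _|n trd htrd].
  have e0 (e e' : nat -> matrix_structure trd) : holds e f <-> holds e' f.
    by apply: holds_ext => v _; apply/matrixP => -[].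
  have [h|h] := classic (holds ((fun=> 0) : nat -> matrix_structure trd) f).
    by exists (Not Bot); split=> // e; split=> [_ []|_]; apply/(e0 _ _).1: h.
  by exists Bot; split=> // e; split=> // he; apply: h; apply/(e0 _ _).1: he.
have [S] : inhabited (star_data D).
  case: hD => [->|[->|->]]; constructor; first exact: real_star_data.
    exact: complex_star_data.
  exact: quaternion_star_data.
have [trdC [q q0 trdE]] := reduced_traceE S htrd.
by apply: (elimination_in_structure trdC _ _ trdE); [exists q|rewrite fmorph_eq0 gt_eqF].
Qed.
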